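(* Assume the setting of the following context with $M\ge 2$ and $H\neq 0$, and let $a:=\frac13\sum_{j\in\{0,1,+\}}\mathrm{Tr}[\sigma_1\rho_j\sigma_1\rho_j]$ and $|E_{\mathrm m}|:=\|H\|_\infty$ (the largest absolute value of an eigenvalue of $H$). Suppose $$0<\delta t<\frac{\sqrt{3-2a}-1}{2|E_{\mathrm m}|},$$ and set $b:=1-a-2|E_{\mathrm m}|\delta t-2E_{\mathrm m}^2\delta t^2$ (so that $b>0$). Let $0<r_0<1$ and let $r>0$ satisfy $$r^2\le\frac{3r_0^2}{M-1}\cdot\frac{b}{1+b}.$$ Then $$\mathrm{Var}_{\boldsymbol\phi\sim\mathcal D(\bar{\boldsymbol\phi},r)}[C(\boldsymbol\phi)]\ \ge\ \frac{4r^4}{45}\Big(1-\frac{4r^2}{7}\Big)\,(1-r_0^2)^2\,b^2 .$$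
   Context: Setting: $\mathcal H=(\mathbb C^2)^{\otimes n}$, $H$ a Hermitian operator on $\mathcal H$, $\delta t>0$, $\mathcal T(\delta t)=e^{-iH\delta t}$. $|\psi_0\rangle,|\psi_1\rangle$ are orthonormal, $|\psi_+\rangle=(|\psi_0\rangle+|\psi_1\rangle)/\sqrt2$, $\rho_j=|\psi_j\rangle\langle\psi_j|$ for $j\in\{0,1,+\}$. For $n$-qubit Pauli strings $\sigma_1,\dots,\sigma_M$ (Hermitian, $\sigma_i^2=I$) and fixed unitaries $W_1,\dots,W_M$, the parameterized circuit is $U(\boldsymbol\phi)=W_M e^{-i\phi_M\sigma_M}\cdots W_1 e^{-i\phi_1\sigma_1}$, $\boldsymbol\phi\in\mathbb R^M$ (so $e^{-i\phi_1\sigma_1}$ acts first). For fixed $\bar{\boldsymbol\phi}\in\mathbb R^M$, the cost is $C(\boldsymbol\phi)=1-\frac13\sum_{j\in\{0,1,+\}}|\langle\psi_j|U^\dagger(\boldsymbol\phi)\mathcal T(\delta t)U(\bar{\boldsymbol\phi})|\psi_j\rangle|^2$. For $r>0$, $\mathcal D(\bar{\boldsymbol\phi},r)$ is the uniform distribution on the hypercube $\{\boldsymbol\phi:\phi_i\in[\bar\phi_i-r,\bar\phi_i+r]\ \forall i\}$. *)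

(* Defs.v *)
From HB Require Import structures.
From mathcomp Require Import all_boot all_order all_algebra.
From mathcomp Require Import complex.
From mathcomp Require Import all_classical all_reals all_analysis.
Set Implicit Arguments. Unset Strict Implicit. Unset Printing Implicit Defensive.
Import Order.TTheory GRing.Theory Num.Theory numFieldNormedType.Exports.
Local Open Scope ring_scope.
Local Open Scope classical_set_scope.

Section Q.
Variable R : realType.
Local Notation C := (complex R).

Definition abs2 (z : C) : R := complex.Re z ^+ 2 + complex.Im z ^+ 2.

Definition adj m n (A : 'M[C]_(m, n)) : 'M[C]_(n, m) := (map_mx (@conjc R) A)^T.

Definition is_hermitian d (A : 'M[C]_d) : Prop := adj A = A.
Definition unitary d (A : 'M[C]_d) : Prop := adj A *m A = 1%:M.

Definition expmx d (A : 'M[C]_d) : 'M[C]_d :=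
  \matrix_(i, j)
    let S := fun N : nat => (\sum_(k < N) (k`!%:R)^-1 *: A ^+ k) i j in
    let re := fun N : nat => (complex.Re (S N) : R) in
    let im := fun N : nat => (complex.Im (S N) : R) in
    Complex (limn re) (limn im).

(* single-qubit Pauli matrices I, X, Y, Z (indexed 0,1,2,3) as entry functions *)
Definition pauli1 (a : 'I_4) (x y : bool) : C :=
  match val a with
  | 0 => if x == y then 1 else 0
  | 1 => if x == y then 0 else 1
  | 2 => if x == y then 0 else (if x then Complex 0 1 else Complex 0 (-1))
  | _ => if x == y then (if x then -1 else 1) else 0
  end.

Definition qbit (k i : nat) : bool := odd (i %/ 2 ^ k).

(* the n-qubit Pauli string P_{p 0} (x) ... (x) P_{p (n-1)} on (C^2)^{(x) n},
   computational basis index i has k-th qubit given by bit k of i *)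
Definition pauli_string (n : nat) (p : 'I_n -> 'I_4) : 'M[C]_(2 ^ n) :=
  \matrix_(i, j) \prod_(k < n) pauli1 (p k) (qbit k i) (qbit k j).

Definition is_pauli_string n (s : 'M[C]_(2 ^ n)) : Prop :=
  exists p : 'I_n -> 'I_4, s = pauli_string p.

Definition rot d (phi : R) (s : 'M[C]_d) : 'M[C]_d :=
  expmx ((- (Complex 0 phi)) *: s).

(* U(phi) = W_M e^{-i phi_M sigma_M} ... W_1 e^{-i phi_1 sigma_1};
   here indices are shifted: gate k (k = 0..M-1) is W k * e^{-i phi k sigma k} *)
Fixpoint circuit d (sigma W : nat -> 'M[C]_d) (phi : nat -> R) (k : nat) : 'M[C]_d :=
  match k with
  | 0 => 1%:M
  | k'.+1 => W k' *m rot (phi k') (sigma k') *m circuit sigma W phi k'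
  end.

Definition expval d (psi : 'cV[C]_d) (A : 'M[C]_d) : C := (adj psi *m A *m psi) 0 0.

Definition dens d (psi : 'cV[C]_d) : 'M[C]_d := psi *m adj psi.

Definition Emax d (H : 'M[C]_d) : R :=
  sup [set x : R | exists l : C, eigenvalue H l /\ `|l| = Complex x 0].

Definition upd (x : nat -> R) (k : nat) (t : R) : nat -> R :=
  fun i => if i == k then t else x i.

(* Expectation of f(phi) for phi uniform on the hypercube
   prod_{i<k} [c i - r, c i + r] (other coordinates equal to x),
   written as iterated normalized Lebesgue integrals. *)
Fixpoint unif_exp (r : R) (c : nat -> R) (k : nat) (f : (nat -> R) -> R)
    (x : nat -> R) : R :=
  match k with
  | 0 => f x
  | k'.+1 => (2 * r)^-1 *
      Rintegral lebesgue_measure `[c k' - r, c k' + r]%classic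
        (fun t => unif_exp r c k' f (upd x k' t))
  end.

Definition unif_var (M : nat) (r : R) (c : nat -> R) (f : (nat -> R) -> R) : R :=
  unif_exp r c M (fun x => f x ^+ 2) c - (unif_exp r c M f c) ^+ 2.

End Q.

(* Main.v *)
(** The fidelity F = 1 - Cost is, in each angle x_k, of the form
    cos^2 u F(x_k := c_k) + sin^2 u F(x_k := c_k + pi/2) + sin u cos u S with
    u = x_k - c_k, because every gate e^{-i phi sigma} is linear in (cos phi, sin phi).
    Testing F against g = cos^2 (x_0 - c_0), centered, gives by Cauchy-Schwarz
    Var F >= lam^2 Var g, where lam is the mean of D - 1 for
    D = 1 + F(x_0 := c_0) - F(x_0 := c_0 + pi/2).
    As 0 <= F <= 1, D is nonnegative, so averaging over each of the other M - 1 angles keeps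
    at least the fraction E cos^2 >= 1 - r^2/3 of its value at the center, and that
    value is at least 1 + b since |e^{-iH dt} - 1| <= |E_m| dt. *)

Require Import Defs.
From HB Require Import structures.
From mathcomp Require Import all_boot all_order all_algebra.
From mathcomp Require Import complex.
From mathcomp Require Import all_classical all_reals all_analysis.
From mathcomp Require Import ring lra.
Import Order.TTheory GRing.Theory Num.Theory numFieldNormedType.Exports.
Set Implicit Arguments. Unset Strict Implicit. Unset Printing Implicit Defensive.
Local Open Scope ring_scope.

(** * Trigonometric inequalities *)

Section TrigBounds.
Variable R : realType.
Implicit Types (f df : R -> R) (x y : R).

(** The obstacle: the contrast F(x_0 := c_0) - F(x_0 := c_0 + pi/2) is controlled only when all
    other angles sit at the centre, but its mean over them is needed, and it may change sign. Adding
    1 buys positivity, at the price that the loss factor multiplies 1 + b instead of b; this is the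
    origin of the quotient b / (1 + b) in the condition on r. The gate of the first angle acts
    first, so a shift of that angle by pi/2 inserts -i sigma_1 directly at the input state. At the
    centre the remaining circuit then cancels by unitarity, up to the evolution. With e = |E_m| dt,
    each fidelity at the centre is at least 1 - e^2, and each shifted one at most
    <psi|sigma_1|psi>^2 + 2e + e^2; the squares <psi|sigma_1|psi>^2 average to a, so the difference
    averages to at least b. The factor in r alone is a Taylor lower bound, valid for every r > 0,
    for Var g, the variance of cos^2 on [-r, r]. *)

Lemma ge0_of_derive_ge0 f df : f 0 = 0 ->
  (forall x, is_derive x (1 : R) f (df x)) ->
  (forall x, 0 <= x -> 0 <= df x) -> forall x, 0 <= x -> 0 <= f x.
Proof.
move=> f0 fdf df0 x x0; rewrite -f0.
apply: (@ger0_derive1_ndecr R f 0 x) => //.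
- by move=> y; rewrite in_itv/= => /andP[/ltW y0 _]; rewrite derive1E derive_val df0.
- by apply: derivable_within_continuous => y _; have := fdf y; case.
Qed.

(** Bottom of a ladder: each of the following bounds integrates the previous one from 0, starting
    from cos <= 1. *)
Lemma sin_le_id x : 0 <= x -> sin x <= x.
Proof.
move=> x0; rewrite -subr_ge0.
apply: (@ge0_of_derive_ge0 (fun x => x - sin x) (fun x => 1 - cos x) _ _ _ x x0).
- by rewrite sin0 subrr.
- by move=> y _; rewrite subr_ge0 cos_le1.
Qed.

Lemma cos_ge_quadratic_pos x : 0 <= x -> 1 - x ^+ 2 / 2 <= cos x.
Proof.
move=> x0; rewrite -subr_ge0.
apply: (@ge0_of_derive_ge0 (fun x => cos x - (1 - x ^+ 2 / 2)) (fun x => x - sin x) _ _ _ x x0).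
- by rewrite cos0; ring.
- by move=> y; apply: is_derive_eq; rewrite /GRing.scale/=; field.
- by move=> y y0; rewrite subr_ge0 sin_le_id.
Qed.

Lemma cos_ge_quadratic x : 1 - x ^+ 2 / 2 <= cos x.
Proof.
have [/cos_ge_quadratic_pos//|/ltW x0] := leP 0 x.
by rewrite -cosN -(sqrrN x) cos_ge_quadratic_pos// oppr_ge0.
Qed.

Lemma sin_ge_cubic x : 0 <= x -> x - x ^+ 3 / 6 <= sin x.
Proof.
move=> x0; rewrite -subr_ge0.
apply: (@ge0_of_derive_ge0 (fun x => sin x - (x - x ^+ 3 / 6))
  (fun x => cos x - (1 - x ^+ 2 / 2)) _ _ _ x x0).
- by rewrite sin0; ring.
- by move=> y; apply: is_derive_eq; rewrite /GRing.scale/=; field.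
- by move=> y y0; rewrite subr_ge0 cos_ge_quadratic.
Qed.

(* The right-hand side is [4 y^2] times the excess of the variance of [cos^2] on
   [-y/4, y/4] over its Taylor bound; its fourth derivative is [y (sin y - y + y^3/6) / 2]. *)
Lemma cos_sq_var_taylor y : 0 <= y ->
  0 <= y ^+ 2 / 2 + y * sin y / 2 - 2 + 2 * cos y
       - 720^-1 * y ^+ 6 + (720 * 28)^-1 * y ^+ 8.
Proof.
move=> y0.
have d3 (a b z : R) : is_derive z (1 : R)
    (fun z => 1 - cos z - z * sin z / 2 - a * z ^+ 4 + b * z ^+ 6)
    ((sin z - z * cos z) / 2 - 4 * a * z ^+ 3 + 6 * b * z ^+ 5).
  by apply: is_derive_eq; rewrite /GRing.scale/=; field.
have d2 (a b z : R) : is_derive z (1 : R)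
    (fun z => z - 3 / 2 * sin z + z * cos z / 2 - a * z ^+ 5 + b * z ^+ 7)
    (1 - cos z - z * sin z / 2 - 5 * a * z ^+ 4 + 7 * b * z ^+ 6).
  by apply: is_derive_eq; rewrite /GRing.scale/=; field.
have d1 (a b z : R) : is_derive z (1 : R)
    (fun z => z ^+ 2 / 2 + z * sin z / 2 - 2 + 2 * cos z - a * z ^+ 6 + b * z ^+ 8)
    (z - 3 / 2 * sin z + z * cos z / 2 - 6 * a * z ^+ 5 + 8 * b * z ^+ 7).
  by apply: is_derive_eq; rewrite /GRing.scale/=; field.
(* This is the third derivative of the target, and its own derivative is visibly nonnegative by the
   cubic bound for the sine. Each later step undoes one differentiation, through [d3], [d2] and
   [d1]. *)
have step4 (z : R) (z0 : 0 <= z) :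
    0 <= (sin z - z * cos z) / 2 - z ^+ 3 / 6 + z ^+ 5 / 60.
  apply: (@ge0_of_derive_ge0
    (fun z => (sin z - z * cos z) / 2 - z ^+ 3 / 6 + z ^+ 5 / 60)
    (fun z => z / 2 * (sin z - (z - z ^+ 3 / 6))) _ _ _ z z0) => {z z0}.
  - by rewrite sin0; ring.
  - by move=> z; apply: is_derive_eq; rewrite /GRing.scale/=; field.
  - by move=> z z0; rewrite mulr_ge0 ?divr_ge0// subr_ge0 sin_ge_cubic.
have step3 (z : R) (z0 : 0 <= z) :
    0 <= 1 - cos z - z * sin z / 2 - 24^-1 * z ^+ 4 + 360^-1 * z ^+ 6.
  apply: (ge0_of_derive_ge0 _ (d3 24^-1 360^-1) _ z0) => [|{}z {}z0].
  - by rewrite cos0; ring.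
  - apply: le_trans (step4 z z0) _; rewrite le_eqVlt; apply/orP; left; apply/eqP.
    by field.
have step2 (z : R) (z0 : 0 <= z) :
    0 <= z - 3 / 2 * sin z + z * cos z / 2 - 120^-1 * z ^+ 5 + (120 * 21)^-1 * z ^+ 7.
  apply: (ge0_of_derive_ge0 _ (d2 120^-1 (120 * 21)^-1) _ z0) => [|{}z {}z0].
  - by rewrite sin0; ring.
  - apply: le_trans (step3 z z0) _; rewrite le_eqVlt; apply/orP; left; apply/eqP.
    by field.
apply: (ge0_of_derive_ge0 _ (d1 720^-1 (720 * 28)^-1) _ y0) => [|z z0].
- by rewrite cos0 sin0; ring.
- apply: le_trans (step2 z z0) _; rewrite le_eqVlt; apply/orP; left; apply/eqP.
  by field.
Qed.

End TrigBounds.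

(** * Averages over an interval *)

Section Average.
Local Open Scope classical_set_scope.
Variables (R : realType) (r : R).
Hypothesis r_gt0 : 0 < r.
Implicit Types (c : R) (h H : R -> R).

Definition avg c h : R :=
  (2 * r)^-1 * Rintegral lebesgue_measure `[c - r, c + r] h.

Let avg_itv c : c - r < c + r.
Proof. by have := r_gt0; lra. Qed.

Lemma continuous_avg_integrable c h : continuous h ->
  lebesgue_measure.-integrable `[c - r, c + r] (EFin \o h).
Proof.
move=> hc; apply: continuous_compact_integrable; first exact: segment_compact.
exact: continuous_subspaceT.
Qed.

Lemma avgD c h1 h2 : continuous h1 -> continuous h2 ->
  avg c (fun t => h1 t + h2 t) = avg c h1 + avg c h2.
Proof.
move=> h1c h2c; rewrite /avg RintegralD//; first by rewrite mulrDr.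
exact: continuous_avg_integrable.
exact: continuous_avg_integrable.
Qed.

Lemma avgZ c a h : continuous h -> avg c (fun t => a * h t) = a * avg c h.
Proof.
move=> hc; rewrite /avg RintegralZl//; first by rewrite mulrCA.
exact: continuous_avg_integrable.
Qed.

Lemma avg_cst c a : avg c (fun=> a) = a.
Proof.
rewrite /avg Rintegral_cst//.
have -> : fine (lebesgue_measure `[c - r, c + r]) = c + r - (c - r) :> R.
  by rewrite lebesgue_measure_itv/= lte_fin avg_itv.
by field; rewrite gt_eqF.
Qed.

Lemma avg_ge0 c h : (forall t, 0 <= h t) -> 0 <= avg c h.
Proof.
move=> h0; apply: mulr_ge0; first by rewrite invr_ge0 mulr_ge0// ltW.
by apply: Rintegral_ge0 => t _; exact: h0.
Qed.

Lemma le_avg c h1 h2 : continuous h1 -> continuous h2 ->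
  (forall t, h1 t <= h2 t) -> avg c h1 <= avg c h2.
Proof.
move=> h1c h2c h12; rewrite ler_pM2l ?invr_gt0 ?mulr_gt0//.
by apply: le_Rintegral => //; exact: continuous_avg_integrable.
Qed.

Lemma avg_antiderivative c h H : continuous h ->
  (forall t, is_derive t (1 : R) H (h t)) ->
  avg c h = (2 * r)^-1 * (H (c + r) - H (c - r)).
Proof.
move=> hc Hh; rewrite /avg /Rintegral (@continuous_FTC2 _ h H)//.
- exact: continuous_subspaceT.
- have Hc : continuous H.
    by move=> t; apply/differentiable_continuous/derivable1_diffP; have := Hh t; case.
  split; last 2 first.
  + by apply: cvg_at_right_filter; exact: Hc.
  + by apply: cvg_at_left_filter; exact: Hc.
  + by move=> t _; have := Hh t; case.
- by move=> t _; rewrite derive1E derive_val.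
Qed.

End Average.

Lemma continuous_cos_shift (R : realType) (a : R) : continuous (fun t : R => cos (t - a)).
Proof.
move=> t; apply: (@continuous_comp _ _ _ (fun t => t - a) cos).
  by apply: cvgB; [exact: cvg_id | exact: cvg_cst].
exact: continuous_cos.
Qed.

Lemma continuous_sin_shift (R : realType) (a : R) : continuous (fun t : R => sin (t - a)).
Proof.
move=> t; apply: (@continuous_comp _ _ _ (fun t => t - a) sin).
  by apply: cvgB; [exact: cvg_id | exact: cvg_cst].
exact: continuous_sin.
Qed.

Lemma continuous_cos_shiftX (R : realType) (a : R) n :
  continuous (fun t : R => cos (t - a) ^+ n).
Proof.
move=> t; apply: (@continuous_comp _ _ _ (fun t => cos (t - a)) (@GRing.exp R ^~ n)).
  exact: continuous_cos_shift.
exact: exprn_continuous.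
Qed.

(** * Moments of cos^2 on an interval *)

Section CosineMoments.
Variables (R : realType) (r c : R).
Hypothesis r_gt0 : 0 < r.

Let dcos (t : R) : is_derive t (1 : R) (fun t : R => cos (t - c)) (- sin (t - c)).
Proof.
have -> : - sin (t - c) = - sin (t - c) * (1 - 0) by ring.
exact: (@is_derive1_comp R cos (fun t => t - c)).
Qed.

Let dsin (t : R) : is_derive t (1 : R) (fun t : R => sin (t - c)) (cos (t - c)).
Proof.
have -> : cos (t - c) = cos (t - c) * (1 - 0) by ring.
exact: (@is_derive1_comp R sin (fun t => t - c)).
Qed.

Definition cos_sq_mean : R := 2^-1 + sin r * cos r / (2 * r).
(** The first two terms are the mean of cos^4, by the reduction formula that lowers cos^4 to
    cos^2. *)
Definition cos_sq_var : R :=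
  3 / 4 * cos_sq_mean + sin r * cos r ^+ 3 / (4 * r) - cos_sq_mean ^+ 2.

Let cr : c + r - c = r. Proof. by ring. Qed.
Let cNr : c - r - c = - r. Proof. by ring. Qed.

Lemma avg_cos_sq : avg r c (fun t => cos (t - c) ^+ 2) = cos_sq_mean.
Proof.
have D (t : R) : is_derive t (1 : R)
    (fun t => (t + sin (t - c) * cos (t - c)) / 2) (cos (t - c) ^+ 2).
  apply: is_derive_eq; rewrite /GRing.scale/=.
  have := cos2Dsin2 (t - c); set C := cos _; set S := sin _ => cs.
  transitivity (C ^+ 2 - 2^-1 * (C ^+ 2 + S ^+ 2 - 1)); first by field.
  by rewrite cs; ring.
rewrite (avg_antiderivative r_gt0 _ _ D); last exact: continuous_cos_shiftX.
by rewrite cr cNr sinN cosN /cos_sq_mean; field; exact: lt0r_neq0.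
Qed.

Lemma avg_cos_pow4 :
  avg r c (fun t => cos (t - c) ^+ 4) = cos_sq_var + cos_sq_mean ^+ 2.
Proof.
have D (t : R) : is_derive t (1 : R)
    (fun t => 4^-1 * (sin (t - c) * cos (t - c) ^+ 3) +
              3 / 8 * (t + sin (t - c) * cos (t - c))) (cos (t - c) ^+ 4).
  apply: is_derive_eq; rewrite /GRing.scale/=.
  have := cos2Dsin2 (t - c); set C := cos _; set S := sin _ => cs.
  transitivity (C ^+ 4 - (3 / 4 * C ^+ 2 + 3 / 8) * (C ^+ 2 + S ^+ 2 - 1)).
    by field.
  by rewrite cs; ring.
rewrite (avg_antiderivative r_gt0 _ _ D); last exact: continuous_cos_shiftX.
by rewrite cr cNr sinN cosN /cos_sq_var /cos_sq_mean; field; exact: lt0r_neq0.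
Qed.

(** The integrand is odd about [c]. This and the next lemma eliminate the uncontrolled cross term of
    a function that is quadratic in (cos, sin). *)
Lemma avg_sin_cos : avg r c (fun t => sin (t - c) * cos (t - c)) = 0.
Proof.
have D (t : R) : is_derive t (1 : R)
    (fun t => sin (t - c) ^+ 2 / 2) (sin (t - c) * cos (t - c)).
  by apply: is_derive_eq; rewrite /GRing.scale/=; field.
rewrite (avg_antiderivative r_gt0 _ _ D).
  by rewrite cr cNr sinN sqrrN subrr mulr0.
by move=> t; apply: cvgM; [exact: continuous_sin_shift|exact: continuous_cos_shift].
Qed.

Lemma avg_sin_cos_pow3 : avg r c (fun t => sin (t - c) * cos (t - c) ^+ 3) = 0.
Proof.
have D (t : R) : is_derive t (1 : R)
    (fun t => - (cos (t - c) ^+ 4 / 4)) (sin (t - c) * cos (t - c) ^+ 3).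
  by apply: is_derive_eq; rewrite /GRing.scale/=; field.
rewrite (avg_antiderivative r_gt0 _ _ D).
  by rewrite cr cNr cosN subrr mulr0.
by move=> t; apply: cvgM; [exact: continuous_sin_shift|exact: continuous_cos_shiftX].
Qed.

(** The quotient in [cos_sq_mean] is sin(2r) / (4r), so the cubic bound for the sine is used at
    2r. *)
Lemma cos_sq_mean_ge : 1 - r ^+ 2 / 3 <= cos_sq_mean.
Proof.
have r0 := ltW r_gt0.
have := @sin_ge_cubic R (r + r) (addr_ge0 r0 r0).
rewrite sinD /cos_sq_mean => h.
have -> : 1 - r ^+ 2 / 3 = 2^-1 + (r + r - (r + r) ^+ 3 / 6) / (4 * r).
  by field; exact: lt0r_neq0.
have -> : sin r * cos r / (2 * r) = (sin r * cos r + cos r * sin r) / (4 * r).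
  by field; exact: lt0r_neq0.
by rewrite lerD2l ler_pM2r// invr_gt0 mulr_gt0.
Qed.

Lemma cos_sq_var_ge : 4 * r ^+ 4 / 45 * (1 - 4 * r ^+ 2 / 7) <= cos_sq_var.
Proof.
have r0 := ltW r_gt0.
(* The Taylor bound is used at y = 4r, because the variance of cos^2 involves sin(4r) and cos(4r).
   Writing 4r as nested sums lets the addition formulas reduce everything to sin r and cos r. *)
have y0 : 0 <= r + r + (r + r) by rewrite !addr_ge0.
have := cos_sq_var_taylor y0.
rewrite (sinD (r + r)) (cosD (r + r)) (sinD r) (cosD r).
have := cos2Dsin2 r; set C := cos r; set S := sin r => cs.
set L := (X in 0 <= X -> _) => L0.
rewrite -subr_ge0 -(@pmulr_rge0 _ (64 * r ^+ 2)) ?mulr_gt0 ?exprn_gt0//.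
suff <- : L = 64 * r ^+ 2 * (cos_sq_var - 4 * r ^+ 4 / 45 * (1 - 4 * r ^+ 2 / 7)) by [].
have S2 : S ^+ 2 = 1 - C ^+ 2 by rewrite -cs; ring.
rewrite /L /cos_sq_var /cos_sq_mean -/S -/C.
transitivity (8 * r ^+ 2 + 8 * r * (S * C * (C ^+ 2 - S ^+ 2)) + 2 * ((C ^+ 2 - S ^+ 2) ^+ 2
  - 4 * S ^+ 2 * C ^+ 2 - 1) - 720^-1 * (4 * r) ^+ 6 + (720 * 28)^-1 * (4 * r) ^+ 8).
  by field.
rewrite S2.
transitivity (8 * r ^+ 2 + 8 * r * (S * C * (2 * C ^+ 2 - 1)) - 16 * (S ^+ 2) * C ^+ 2
 - 720^-1 * (4 * r) ^+ 6 + (720 * 28)^-1 * (4 * r) ^+ 8).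
  by rewrite S2; field.
by field; exact: lt0r_neq0.
Qed.

End CosineMoments.

(** * Expectations over the hypercube *)

Section Separable.
Variables (R : realType) (N : nat).
Implicit Types (f g : (nat -> R) -> R) (x : nat -> R) (k : nat) (t : R).

(* Finite sums of products of continuous one-variable functions of the first [N]
   coordinates: iterated integration preserves this class, so no joint
   measurability is ever needed. *)
Inductive separable : ((nat -> R) -> R) -> Prop :=
| separable_prod a (h : nat -> R -> R) : (forall i, continuous (h i)) ->
    separable (fun x => a * \prod_(i < N) h i (x i))
| separableD f g : separable f -> separable g -> separable (fun x => f x + g x).

Lemma separable_cst a : separable (fun=> a).
Proof.
have -> : (fun=> a) = (fun x : nat -> R => a * \prod_(i < N) (fun=> 1) (x i)).
  by apply/funext => x; rewrite big1 ?mulr1.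
by apply: (@separable_prod a (fun _ _ => 1)) => i t; exact: cvg_cst.
Qed.

Lemma separable_coord i (h : R -> R) : (i < N)%N -> continuous h ->
  separable (fun x => h (x i)).
Proof.
move=> iN hc.
have -> : (fun x : nat -> R => h (x i)) =
    (fun x => 1 * \prod_(j < N) (if j == i :> nat then h else fun=> 1) (x j)).
  apply/funext => x; rewrite mul1r (bigD1 (Ordinal iN))//= eqxx big1 ?mulr1// => j.
  by rewrite -val_eqE/= => /negbTE ->.
apply: (@separable_prod 1 (fun j => if j == i then h else fun=> 1)) => j.
by case: eqP => // _ t; exact: cvg_cst.
Qed.

Lemma separableM f g : separable f -> separable g -> separable (fun x => f x * g x).
Proof.
move=> fs gs; elim: fs => {f} [a h hc|f1 f2 _ ih1 _ ih2]; last first.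
  have -> : (fun x => (f1 x + f2 x) * g x) = (fun x => f1 x * g x + f2 x * g x).
    by apply/funext => x; rewrite mulrDl.
  exact: separableD.
elim: gs => {g} [b l lc|g1 g2 _ ih1 _ ih2]; last first.
  set u := fun x => _ * _ in ih1 ih2 *.
  have -> : (fun x => a * \prod_(i < N) h i (x i) * (g1 x + g2 x)) =
    (fun x => a * \prod_(i < N) h i (x i) * g1 x + a * \prod_(i < N) h i (x i) * g2 x).
    by apply/funext => x; rewrite mulrDr.
  exact: separableD.
have -> : (fun x => a * \prod_(i < N) h i (x i) * (b * \prod_(i < N) l i (x i))) =
    (fun x => a * b * \prod_(i < N) (fun t => h i t * l i t) (x i)).
  by apply/funext => x; rewrite big_split/= mulrACA.
by apply: (@separable_prod _ (fun i t => h i t * l i t)) => i t; apply: cvgM;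
  [exact: hc|exact: lc].
Qed.

Lemma separableZ a f : separable f -> separable (fun x => a * f x).
Proof. exact: (separableM (separable_cst a)). Qed.

Lemma separableB f g : separable f -> separable g -> separable (fun x => f x - g x).
Proof.
move=> fs gs; have -> : (fun x => f x - g x) = (fun x => f x + -1 * g x).
  by apply/funext => x; rewrite mulN1r.
by apply: separableD => //; exact: separableZ.
Qed.

Lemma prod_upd (h : nat -> R -> R) x k t (kN : (k < N)%N) :
  \prod_(i < N) h i (upd x k t i) = h k t * \prod_(i < N | i != k :> nat) h i (x i).
Proof.
rewrite (bigD1 (Ordinal kN))//= /upd eqxx; congr (_ * _).
by apply: eq_bigr => i; rewrite -val_eqE/= => /negbTE ->.
Qed.

Lemma separable_upd f k t : (k < N)%N -> separable f -> separable (fun x => f (upd x k t)).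
Proof.
move=> kN; elim=> {f} [a h hc|f g _ ihf _ ihg]; last exact: separableD.
have -> : (fun x => a * \prod_(i < N) h i (upd x k t i)) =
    (fun x => a * \prod_(i < N) (if i == k :> nat then fun=> h k t else h i) (x i)).
  apply/funext => x; rewrite prod_upd// [in RHS](bigD1 (Ordinal kN))//= eqxx.
  by congr (_ * (_ * _)); apply: eq_bigr => i /negbTE ->.
apply: (@separable_prod a (fun i => if i == k then fun=> h k t else h i)) => i.
by case: eqP => // _ u; exact: cvg_cst.
Qed.

Lemma separable_continuous f x k : (k < N)%N -> separable f ->
  continuous (fun t => f (upd x k t)).
Proof.
move=> kN; elim=> {f} [a h hc|f g _ ihf _ ihg] t.
  have -> : (fun t => a * \prod_(i < N) h i (upd x k t i)) =
     (fun t => a * \prod_(i < N | i != k :> nat) h i (x i) * h k t).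
    by apply/funext => u; rewrite prod_upd// mulrA mulrAC.
  by apply: cvgM; [exact: cvg_cst|exact: hc].
by apply: cvgD; [exact: ihf|exact: ihg].
Qed.

(** In each product only the factor of coordinate [k] is integrated; it becomes a constant factor,
    so the product form survives. *)
Lemma separable_avg r (c : R) f k : 0 < r -> (k < N)%N -> separable f ->
  separable (fun x => avg r c (fun t => f (upd x k t))).
Proof.
move=> r0 kN; elim=> {f} [a h hc|f g fs ihf gs ihg].
  have -> : (fun x => avg r c (fun t => a * \prod_(i < N) h i (upd x k t i))) =
      (fun x => a * \prod_(i < N) (if i == k :> nat then fun=> avg r c (h k) else h i) (x i)).
    apply/funext => x; rewrite [in RHS](bigD1 (Ordinal kN))//= eqxx.
    have -> : (fun t => a * \prod_(i < N) h i (upd x k t i)) =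
       (fun t => a * \prod_(i < N | i != k :> nat) h i (x i) * h k t).
      by apply/funext => u; rewrite prod_upd// mulrA mulrAC.
    rewrite avgZ// mulrAC -mulrA; congr (_ * (_ * _)).
    by apply: eq_bigr => i /negbTE ->.
  apply: (@separable_prod a (fun i => if i == k then fun=> avg r c (h k) else h i)) => i.
  by case: eqP => // _ u; exact: cvg_cst.
have -> : (fun x => avg r c (fun t => f (upd x k t) + g (upd x k t))) =
    (fun x => avg r c (fun t => f (upd x k t)) + avg r c (fun t => g (upd x k t))).
  by apply/funext => x; rewrite avgD//; exact: separable_continuous.
exact: separableD.
Qed.

End Separable.

(** * Linearity and lower bounds for iterated averages *)

Section UniformExpectation.
Variables (R : realType) (N : nat) (r : R) (c : nat -> R).
Hypothesis r_gt0 : 0 < r.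
Implicit Types (f g : (nat -> R) -> R) (x : nat -> R) (k : nat) (t : R).
Local Notation sep := (@separable R N).
Local Notation E := (unif_exp r c).

Lemma unif_expS k f x : E k.+1 f x = avg r (c k) (fun t => E k f (upd x k t)).
Proof. by []. Qed.

Lemma separable_unif_exp k f : (k <= N)%N -> sep f -> sep (E k f).
Proof.
by move=> + fs; elim: k => [|k ih] kN //; apply: separable_avg => //; exact: ih (ltnW kN).
Qed.

Lemma unif_expD k f g x : (k <= N)%N -> sep f -> sep g ->
  E k (fun x => f x + g x) x = E k f x + E k g x.
Proof.
move=> + fs gs; elim: k x => [//|k ih] x kN; rewrite !unif_expS.
under [in LHS]eq_fun do rewrite ih ?(ltnW kN)//.
rewrite avgD//.
- by apply: (@separable_continuous _ N (E k f)) => //; apply: separable_unif_exp => //; exact: ltnW.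
- by apply: (@separable_continuous _ N (E k g)) => //; apply: separable_unif_exp => //; exact: ltnW.
Qed.

Lemma unif_expZ k a f x : (k <= N)%N -> sep f ->
  E k (fun x => a * f x) x = a * E k f x.
Proof.
move=> + fs; elim: k x => [//|k ih] x kN; rewrite !unif_expS.
under [in LHS]eq_fun do rewrite ih ?(ltnW kN)//.
rewrite avgZ//.
by apply: (@separable_continuous _ N (E k f)) => //; apply: separable_unif_exp => //; exact: ltnW.
Qed.

Lemma unif_expB k f g x : (k <= N)%N -> sep f -> sep g ->
  E k (fun x => f x - g x) x = E k f x - E k g x.
Proof.
move=> kN fs gs.
have -> : (fun x => f x - g x) = (fun x => f x + -1 * g x).
  by apply/funext => y; rewrite mulN1r.
by rewrite unif_expD// ?unif_expZ ?mulN1r//; exact: separableZ.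
Qed.

Lemma unif_exp_cst k a x : E k (fun=> a) x = a.
Proof.
elim: k x => [//|k ih] x; rewrite unif_expS.
by under eq_fun do rewrite ih; rewrite avg_cst.
Qed.

Lemma unif_exp_ge0 k f x : (forall y, 0 <= f y) -> 0 <= E k f x.
Proof. by move=> f0; elim: k x => [//|k ih] x; rewrite unif_expS avg_ge0. Qed.

Definition recenter k x : nat -> R := fun i => if (i < k)%N then c i else x i.

(** The induction hypothesis bounds the inner average from below for each value [t] of the outer
    coordinate; the hypothesis on coordinate [k] is then applied at a point whose lower coordinates
    already sit at the centre. Hence the one-coordinate inequality is required of [f] itself, not of
    its partial averages. *)
Lemma unif_exp_ge_center (w : nat -> R) f : sep f -> (forall k, 0 <= w k) ->
  (forall k x, (k < N)%N ->
    w k * f (upd x k (c k)) <= avg r (c k) (fun t => f (upd x k t))) ->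
  forall k x, (k <= N)%N -> (\prod_(i < k) w i) * f (recenter k x) <= E k f x.
Proof.
move=> fs w0 fw; elim=> [|k ih] x kN.
  by rewrite big_ord0 mul1r.
rewrite unif_expS big_ord_recr/= -mulrA.
have recS : recenter k.+1 x = upd (recenter k x) k (c k).
  by apply/funext => i; rewrite /recenter /upd ltnS leq_eqVlt; case: eqP => // ->.
have recU t : recenter k (upd x k t) = upd (recenter k x) k t.
  by apply/funext => i; rewrite /recenter /upd; case: eqP => // ->; rewrite ltnn.
have W0 : 0 <= \prod_(i < k) w i by apply: prodr_ge0.
rewrite recS; apply: (le_trans (ler_wpM2l W0 (fw k (recenter k x) kN))).
rewrite -avgZ//; last exact: (@separable_continuous _ N f (recenter k x) k kN fs).
apply: le_avg => //.
- move=> t; apply: cvgM; first exact: cvg_cst.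
  exact: (@separable_continuous _ N f (recenter k x) k kN fs).
- by apply: (@separable_continuous _ N (E k f)) => //; apply: separable_unif_exp => //; exact: ltnW.
- by move=> t; rewrite -recU; apply: ih; exact: ltnW.
Qed.

End UniformExpectation.

(** * The variance bound *)

Section UpdTheory.
Variable R : realType.
Implicit Types (x : nat -> R) (k : nat) (t : R).

Lemma upd_id x k : upd x k (x k) = x.
Proof. by apply/funext => i; rewrite /upd; case: eqP => // ->. Qed.

Lemma upd_upd x k t u : upd (upd x k t) k u = upd x k u.
Proof. by apply/funext => i; rewrite /upd; case: eqP. Qed.

Lemma updC x k l t u : k != l -> upd (upd x k t) l u = upd (upd x l u) k t.
Proof.
move=> kl; apply/funext => i; rewrite /upd; case: eqP => // ->.
by rewrite eq_sym (negbTE kl).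
Qed.

End UpdTheory.

Lemma bernoulli_le (R : realType) (q : R) n : 0 <= q <= 1 -> 1 - n%:R * q <= (1 - q) ^+ n.
Proof.
move=> /andP[q0 q1]; elim: n => [|n ih]; first by rewrite mul0r subr0.
rewrite exprS; apply: le_trans (ler_wpM2l _ ih); last by rewrite subr_ge0.
rewrite -subr_ge0 (_ : _ - _ = n%:R * q ^+ 2); last by rewrite -natr1; ring.
by rewrite mulr_ge0 ?sqr_ge0.
Qed.

Section Variance.
Variables (R : realType) (M' : nat) (r : R) (c : nat -> R).
Local Notation M := M'.+1.
Hypothesis r_gt0 : 0 < r.
Implicit Types (f : (nat -> R) -> R) (x : nat -> R) (k : nat) (t : R).
Local Notation E := (unif_exp r c).
Local Notation m := (cos_sq_mean r).
Local Notation V := (cos_sq_var r).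

(* Pointwise values of [|u cos a + v sin a|^2] as a function of the angle [a = t - c k]. *)
Definition quadratic_in k f := forall x, exists s, forall t,
  f (upd x k t) = cos (t - c k) ^+ 2 * f (upd x k (c k))
    + sin (t - c k) ^+ 2 * f (upd x k (c k + pi / 2)) + sin (t - c k) * cos (t - c k) * s.

Let csc a n : continuous (fun t : R => sin (t - a) * cos (t - a) ^+ n).
Proof. by move=> t; apply: cvgM; [exact: continuous_sin_shift|exact: continuous_cos_shiftX]. Qed.

Let cZ a (h : R -> R) : continuous h -> continuous (fun t => a * h t).
Proof. by move=> hc t; apply: cvgM; [exact: cvg_cst|exact: hc]. Qed.

Let cD (h1 h2 : R -> R) : continuous h1 -> continuous h2 ->
  continuous (fun t => h1 t + h2 t).
Proof. by move=> h1c h2c t; apply: cvgD; [exact: h1c|exact: h2c]. Qed.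

(** A common normal form for the integrands below, padded with zero coefficients where terms are
    absent. The odd terms average to 0, and [V + m ^+ 2] is the fourth moment of the cosine. *)
Lemma avg_trig_poly a (u0 u2 u4 s1 s3 : R) :
  avg r a (fun t => u0 + (u2 * cos (t - a) ^+ 2 + (u4 * cos (t - a) ^+ 4 +
     (s1 * (sin (t - a) * cos (t - a) ^+ 1) + s3 * (sin (t - a) * cos (t - a) ^+ 3))))) =
  u0 + u2 * m + u4 * (V + m ^+ 2).
Proof.
have c0 : continuous (fun _ : R => u0) by move=> t; exact: cvg_cst.
have c2 := @continuous_cos_shiftX R a 2; have c4 := @continuous_cos_shiftX R a 4.
have C2 := @cZ u2 _ c2; have C4 := @cZ u4 _ c4.
have S1 := @cZ s1 _ (@csc a 1); have S3 := @cZ s3 _ (@csc a 3).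
have T1 := cD S1 S3; have T2 := cD C4 T1; have T3 := cD C2 T2.
rewrite !avgD//.
rewrite avg_cst// !avgZ//.
rewrite (avg_cos_sq a r_gt0) (avg_cos_pow4 a r_gt0) (avg_sin_cos_pow3 a r_gt0).
by rewrite (avg_sin_cos a r_gt0); ring.
Qed.

Lemma cos_sq_mean_ge0 : 0 <= m.
Proof. by rewrite -(avg_cos_sq 0 r_gt0) avg_ge0// => t; rewrite sqr_ge0. Qed.

Lemma cos_sq_mean_le1 : m <= 1.
Proof.
rewrite -(avg_cos_sq 0 r_gt0) -[leRHS](avg_cst r_gt0 0); apply: le_avg => //.
- exact: continuous_cos_shiftX.
- by move=> t; exact: cvg_cst.
Qed.

Lemma avg_quadratic k f x : quadratic_in k f ->
  avg r (c k) (fun t => f (upd x k t)) =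
  m * f (upd x k (c k)) + (1 - m) * f (upd x k (c k + pi / 2)).
Proof.
move=> /(_ x)[s fE]; set p := f _ in fE *; set q := f _ in fE *.
transitivity (avg r (c k) (fun t => q + ((p - q) * cos (t - c k) ^+ 2 +
  (0 * cos (t - c k) ^+ 4 + (s * (sin (t - c k) * cos (t - c k) ^+ 1) +
   0 * (sin (t - c k) * cos (t - c k) ^+ 3)))))).
  by congr (avg _ _ _); apply/funext => t; rewrite fE sin2cos2; ring.
by rewrite avg_trig_poly; ring.
Qed.

(** With sin^2 = 1 - cos^2 the function becomes q + (p - q) cos^2 plus an odd term, so its
    covariance with cos^2 is p - q times the variance of cos^2. *)
Lemma avg_quadratic_centered k f x : quadratic_in k f ->
  avg r (c k) (fun t => f (upd x k t) * (cos (t - c k) ^+ 2 - m)) =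
  V * (f (upd x k (c k)) - f (upd x k (c k + pi / 2))).
Proof.
move=> /(_ x)[s fE]; set p := f _ in fE *; set q := f _ in fE *.
transitivity (avg r (c k) (fun t => - (m * q) + ((q - m * (p - q)) * cos (t - c k) ^+ 2 +
  ((p - q) * cos (t - c k) ^+ 4 + (- (m * s) * (sin (t - c k) * cos (t - c k) ^+ 1) +
   s * (sin (t - c k) * cos (t - c k) ^+ 3)))))).
  by congr (avg _ _ _); apply/funext => t; rewrite fE sin2cos2; ring.
by rewrite avg_trig_poly; ring.
Qed.

(** Coordinate 0 is the innermost integral of [unif_exp], so an identity that holds after averaging
    over the first angle alone propagates outward without exchanging integrals. *)
Lemma eq_unif_expS k f g x : (forall y, E 1 f y = E 1 g y) -> E k.+1 f x = E k.+1 g x.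
Proof.
move=> fg; elim: k x => [//|k ih] x; rewrite unif_expS [RHS]unif_expS.
by congr (avg _ _ _); apply/funext => t.
Qed.

Section QuadraticFunction.
Variable F : (nat -> R) -> R.
Hypothesis F_sep : separable M F.
Hypothesis F01 : forall x, 0 <= F x <= 1.
Hypothesis F_quad : forall k, (k < M)%N -> quadratic_in k F.

Let P x := F (upd x 0 (c 0)).
Let Q x := F (upd x 0 (c 0 + pi / 2)).
Let D x := 1 + P x - Q x.
Let lam := E M P c - E M Q c.
Let g x := cos (x 0%N - c 0%N) ^+ 2 - m.

Let P_sep : separable M P. Proof. exact: separable_upd. Qed.
Let Q_sep : separable M Q. Proof. exact: separable_upd. Qed.
Let D_sep : separable M D.
Proof. by apply: separableB => //; apply: separableD => //; exact: separable_cst. Qed.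

Let g_sep : separable M g.
Proof.
apply: (@separable_coord _ _ 0 (fun t => cos (t - c 0%N) ^+ 2 - m)) => // t.
by apply: cvgB; [exact: continuous_cos_shiftX|exact: cvg_cst].
Qed.

Let D_upd0 x t : D (upd x 0 t) = D x.
Proof. by rewrite /D /P /Q !upd_upd. Qed.

Let D_ge0 x : 0 <= D x.
Proof.
by have /andP[? _] := F01 (upd x 0 (c 0));
  have /andP[_ ?] := F01 (upd x 0 (c 0 + pi / 2)); rewrite /D /P /Q; lra.
Qed.

(** The added constant fits the quadratic form because 1 = cos^2 + sin^2; [k] differs from 0 so that
    updates at [k] and at 0 commute. *)
Let D_quad k : (0 < k < M)%N -> quadratic_in k D.
Proof.
move=> /andP[k0 kM] x.
have [sp Ep] := F_quad kM (upd x 0 (c 0)).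
have [sq Eq] := F_quad kM (upd x 0 (c 0 + pi / 2)).
exists (sp - sq) => t; have k0' : k != 0%N by rewrite -lt0n.
by rewrite /D /P /Q !(updC _ _ _ k0') Ep Eq sin2cos2; ring.
Qed.

(** [D] is constant in coordinate 0, which therefore has weight 1 and leaves the exponent [M']. Each
    other coordinate costs a factor [m]: the term with weight 1 - m, at the angle shifted by pi/2,
    is nonnegative and is dropped. *)
Lemma unif_exp_contrast_ge : m ^+ M' * D c <= E M D c.
Proof.
have := @unif_exp_ge_center _ M r c r_gt0 (fun k => if k == 0%N then 1 else m) D D_sep.
move=> /(_ _ _ M c (leqnn _)).
rewrite big_ord_recl mul1r/= prodr_const card_ord.
have -> : recenter c M c = c by apply/funext => i; rewrite /recenter; case: ifP.
apply.
- by move=> k; case: eqP => // _; exact: cos_sq_mean_ge0.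
- move=> [|k] x kM/=.
    by under eq_fun do rewrite D_upd0; rewrite avg_cst// mul1r D_upd0.
  by rewrite (avg_quadratic _ (D_quad _))// lerDl mulr_ge0// subr_ge0 cos_sq_mean_le1.
Qed.

(* Testing F - E F against the single function [g] replaces conditioning on the
   first coordinate: by Cauchy-Schwarz the variance is at least Cov(F, g)^2 / Var g. *)
Lemma unif_var_ge : V * lam ^+ 2 <= unif_var M r c F.
Proof.
have Eg : E M g c = 0.
  transitivity (E M (fun=> 0) c); last exact: unif_exp_cst.
  apply: eq_unif_expS => y; rewrite unif_exp_cst// unif_expS/= /g/=.
  transitivity (avg r (c 0%N) (fun t => - m + (1 * cos (t - c 0%N) ^+ 2 +
    (0 * cos (t - c 0%N) ^+ 4 + (0 * (sin (t - c 0%N) * cos (t - c 0%N) ^+ 1) +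
    0 * (sin (t - c 0%N) * cos (t - c 0%N) ^+ 3)))))).
    by congr (avg _ _ _); apply/funext => t; rewrite /upd/=; ring.
  by rewrite avg_trig_poly; ring.
have Eg2 : E M (fun x => g x ^+ 2) c = V.
  transitivity (E M (fun=> V) c); last exact: unif_exp_cst.
  apply: eq_unif_expS => y; rewrite unif_exp_cst// unif_expS/= /g/=.
  transitivity (avg r (c 0%N) (fun t => m ^+ 2 + (- (2 * m) * cos (t - c 0%N) ^+ 2 +
    (1 * cos (t - c 0%N) ^+ 4 + (0 * (sin (t - c 0%N) * cos (t - c 0%N) ^+ 1) +
    0 * (sin (t - c 0%N) * cos (t - c 0%N) ^+ 3)))))).
    by congr (avg _ _ _); apply/funext => t; rewrite /upd/=; ring.
  by rewrite avg_trig_poly; ring.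
have EFg : E M (fun x => F x * g x) c = V * lam.
  transitivity (E M (fun x => V * (P x - Q x)) c); last first.
    by rewrite (@unif_expZ _ M)// ?(@unif_expB _ M)//; exact: separableB.
  apply: eq_unif_expS => y; rewrite !unif_expS/=.
  transitivity (avg r (c 0%N) (fun t => F (upd y 0 t) * (cos (t - c 0%N) ^+ 2 - m))).
    by [].
  rewrite (avg_quadratic_centered _ (F_quad _))//.
  by rewrite /P /Q; under eq_fun do rewrite !upd_upd; rewrite avg_cst.
set e := E M F c.
(* The least-squares residual: as E g = 0, E g^2 = V and E (F g) = V lam, its mean square expands to
   Var F - V lam^2. *)
have := @unif_exp_ge0 _ r c r_gt0 M (fun x => (F x - e - lam * g x) ^+ 2) c.
move=> /(_ (fun=> sqr_ge0 _)).
have -> : (fun x => (F x - e - lam * g x) ^+ 2) = (fun x => F x ^+ 2 + ((- (2 * e)) * F x +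
   ((- (2 * lam)) * (F x * g x) + (lam ^+ 2 * g x ^+ 2 + ((2 * e * lam) * g x + e ^+ 2))))).
  by apply/funext => x; ring.
have F2 : separable M (fun x => F x ^+ 2) by exact: separableM.
have g2 : separable M (fun x => g x ^+ 2) by exact: separableM.
have Fg : separable M (fun x => F x * g x) by exact: separableM.
have sc := @separable_cst R M (e ^+ 2).
have s1 := separableD (separableZ (2 * e * lam) g_sep) sc.
have s2 := separableD (separableZ (lam ^+ 2) g2) s1.
have s3 := separableD (separableZ (- (2 * lam)) Fg) s2.
have s4 := separableD (separableZ (- (2 * e)) F_sep) s3.
have ZF := separableZ (- (2 * e)) F_sep; have ZFg := separableZ (- (2 * lam)) Fg.
have Zg2 := separableZ (lam ^+ 2) g2; have Zg := separableZ (2 * e * lam) g_sep.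
have ED := fun f g => @unif_expD R M r c r_gt0 M f g c (leqnn M).
have EZ := fun a f => @unif_expZ R M r c r_gt0 M a f c (leqnn M).
rewrite (ED _ _ F2 s4) (ED _ _ ZF s3) (ED _ _ ZFg s2) (ED _ _ Zg2 s1) (ED _ _ Zg sc).
rewrite (EZ _ _ F_sep) (EZ _ _ Fg) (EZ _ _ g2) (EZ _ _ g_sep) unif_exp_cst// Eg Eg2 EFg -/e.
by rewrite /unif_var -/e; lra.
Qed.

(** By Bernoulli, with base nonnegative as r^2 <= 3, the mean of [D] is at least (1 - M' r^2/3)(1 +
    b). Subtracting 1 leaves b - M' (r^2/3)(1 + b), and the last hypothesis bounds the loss by r0^2
    b. *)
Lemma unif_var_ge_contrast (b r0 : R) : r ^+ 2 <= 3 -> 0 <= b -> r0 ^+ 2 <= 1 ->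
  b <= F c - F (upd c 0 (c 0%N + pi / 2)) ->
  M'%:R * (r ^+ 2 / 3) * (1 + b) <= r0 ^+ 2 * b ->
  4 * r ^+ 4 / 45 * (1 - 4 * r ^+ 2 / 7) * (1 - r0 ^+ 2) ^+ 2 * b ^+ 2
    <= unif_var M r c F.
Proof.
move=> r3 b0 r01 bF Mb; apply: le_trans unif_var_ge.
have lamE : lam = E M D c - 1.
  rewrite /D (@unif_expB _ M)//; last first.
    by apply: separableD => //; exact: separable_cst.
  by rewrite (@unif_expD _ M)//; [rewrite unif_exp_cst// /lam; ring|exact: separable_cst].
have Dc : 1 + b <= D c by rewrite /D /P upd_id /Q; lra.
have q01 : 0 <= r ^+ 2 / 3 <= 1 by rewrite divr_ge0 ?sqr_ge0//=; lra.
have mM : 1 - M'%:R * (r ^+ 2 / 3) <= m ^+ M'.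
  apply: le_trans (bernoulli_le M' q01) _.
  rewrite lerXn2r ?nnegrE ?cos_sq_mean_ge0 ?cos_sq_mean_ge//.
  by move/andP: q01 => [_ ?]; rewrite subr_ge0.
have lam_ge : (1 - r0 ^+ 2) * b <= lam.
  rewrite lamE; have := unif_exp_contrast_ge.
  have : m ^+ M' * (1 + b) <= m ^+ M' * D c by rewrite ler_wpM2l// exprn_ge0// cos_sq_mean_ge0.
  have : (1 - M'%:R * (r ^+ 2 / 3)) * (1 + b) <= m ^+ M' * (1 + b).
    by rewrite ler_wpM2r// addr_ge0.
  by move: Mb; set X := M'%:R * _; set Y := m ^+ M'; lra.
have lb0 : 0 <= (1 - r0 ^+ 2) * b by rewrite mulr_ge0// subr_ge0.
(* The Taylor bound does not give this, since 1 - 4r^2/7 is negative once r^2 > 7/4. Instead V is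
   exhibited as the mean of (cos^2 - m)^2. *)
have V0 : 0 <= V.
  have := avg_trig_poly 0 (m ^+ 2) (- (2 * m)) 1 0 0.
  have -> : m ^+ 2 + - (2 * m) * m + 1 * (V + m ^+ 2) = V by ring.
  move=> <-; apply: avg_ge0 => // t.
  suff -> : forall C S : R, m ^+ 2 + (- (2 * m) * C ^+ 2 + (1 * C ^+ 4 +
     (0 * (S * C ^+ 1) + 0 * (S * C ^+ 3)))) = (C ^+ 2 - m) ^+ 2 by exact: sqr_ge0.
  by move=> C S; ring.
rewrite -mulrA -exprMn; apply: (@le_trans _ _ (V * ((1 - r0 ^+ 2) * b) ^+ 2)).
  by rewrite ler_wpM2r ?sqr_ge0// cos_sq_var_ge.
by rewrite ler_wpM2l// lerXn2r// nnegrE// (le_trans lb0).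
Qed.

End QuadraticFunction.
End Variance.

(** * Pauli strings *)

Section PauliStrings.
Variable R : realType.
Local Notation C := (complex R).

(** Induction on the highest bit, which cuts the range below 2^(n+1) into two translates of the
    range below 2^n with the same lower bits. It serves as the mixed-product rule for tensor
    products, in index form. *)
Lemma sum_prod_qbit n (G : nat -> bool -> C) :
  \sum_(j < 2 ^ n) \prod_(k < n) G k (qbit k j) = \prod_(k < n) (G k false + G k true).
Proof.
rewrite -(big_mkord xpredT (fun j => \prod_(k < n) G k (qbit k j))).
elim: n => [|n ih]; first by rewrite expn0 big_nat1 !big_ord0.
rewrite expnS mul2n -addnn big_ord_recr/= -ih (big_cat_nat (n := (2 ^ n)%N))//=; last first.
  by rewrite leq_addr.
rewrite mulrDr; congr (_ + _).
  rewrite big_distrl/=; apply: eq_big_nat => j /andP[_ jn].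
  by rewrite big_ord_recr/= {2}/qbit divn_small.
rewrite -{1}[(2 ^ n)%N]add0n big_addn addnK big_distrl/=.
apply: eq_big_nat => j /andP[_ jn]; rewrite big_ord_recr/=; congr (_ * _).
  apply: eq_bigr => k _; congr (G _ _); rewrite /qbit.
  have -> : (2 ^ n = 2 ^ (n - k) * 2 ^ k)%N by rewrite -expnD subnK// ltnW.
  rewrite addnC divnMDl ?expn_gt0// oddD.
  by rewrite oddX subn_eq0 leqNgt ltn_ord.
by congr (G _ _); rewrite /qbit divnDr// divn_small// divnn expn_gt0.
Qed.

Lemma qbit_inj n (i j : nat) : (i < 2 ^ n)%N -> (j < 2 ^ n)%N ->
  (forall k, (k < n)%N -> qbit k i = qbit k j) -> i = j.
Proof.
elim: n i j => [|n ih] i j; first by rewrite expn0 !ltnS !leqn0 => /eqP -> /eqP ->.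
move=> iN jN ij.
have := ij 0%N isT; rewrite /qbit expn0 !divn1 => odd_ij.
rewrite -(odd_double_half i) -(odd_double_half j) odd_ij; congr (_ + _.*2)%N.
apply: ih.
- by rewrite -divn2 ltn_divLR// mulnC -expnS.
- by rewrite -divn2 ltn_divLR// mulnC -expnS.
- move=> k kn; have := ij k.+1 kn.
  by rewrite /qbit expnS !divnMA !divn2.
Qed.

Lemma pauli1_conj a x y : conjc (pauli1 R a y x) = pauli1 R a x y.
Proof.
rewrite /pauli1; case: (val a) => [|[|[|?]]]; case: x; case: y => /=;
  by apply/eqP; rewrite eq_complex/= ?oppr0 ?opprK ?eqxx.
Qed.

Lemma pauli1_sqr a x y :
  pauli1 R a x false * pauli1 R a false y + pauli1 R a x true * pauli1 R a true y
  = (x == y)%:R.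
Proof.
rewrite /pauli1; case: (val a) => [|[|[|?]]]; case: x; case: y => /=;
  by apply/eqP; rewrite eq_complex/=; apply/andP; split; apply/eqP; ring.
Qed.

Lemma pauli_string_adj n (p : 'I_n -> 'I_4) : adj (pauli_string R p) = pauli_string R p.
Proof.
apply/matrixP => i j; rewrite !mxE rmorph_prod; apply: eq_bigr => k _.
exact: pauli1_conj.
Qed.

Lemma pauli_string_sqr n (p : 'I_n -> 'I_4) :
  pauli_string R p *m pauli_string R p = 1%:M.
Proof.
apply/matrixP => i j; rewrite !mxE.
(* [sum_prod_qbit] takes factors indexed by all naturals, so [p] is extended by the default [ord0],
   which no index below [n] reaches. *)
pose q (k : nat) : 'I_4 := oapp p ord0 (insub k).
pose G (k : nat) b := pauli1 R (q k) (qbit k i) b * pauli1 R (q k) b (qbit k j).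
transitivity (\sum_(l < 2 ^ n) \prod_(k < n) G k (qbit k l)).
  apply: eq_bigr => l _; rewrite !mxE -big_split/=; apply: eq_bigr => k _.
  by rewrite /G /q valK.
rewrite sum_prod_qbit; under eq_bigr do rewrite /G pauli1_sqr.
have [<-|ij] := eqVneq i j; first by rewrite big1// => k _; rewrite eqxx.
have : ~~ [forall k : 'I_n, qbit k i == qbit k j].
  apply: contra ij => /forallP ij; apply/eqP/val_inj/(@qbit_inj n); rewrite ?ltn_ord// => k kn.
  exact/eqP/(ij (Ordinal kn)).
rewrite negb_forall => /existsP[k /negbTE kij].
by rewrite (bigD1 k)//= kij mul0r.
Qed.

End PauliStrings.

(** * Matrices and their exponentials *)

Section ComplexLinearAlgebra.
Variable R : realType.
Local Notation C := (complex R).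

Lemma adjM m n p (A : 'M[C]_(m, n)) (B : 'M[C]_(n, p)) :
  adj (A *m B) = adj B *m adj A.
Proof. by rewrite /adj map_mxM trmx_mul. Qed.

Lemma adjK m n (A : 'M[C]_(m, n)) : adj (adj A) = A.
Proof. by apply/matrixP => i j; rewrite !mxE conjcK. Qed.

Lemma adj1 n : adj (1%:M : 'M[C]_n) = 1%:M.
Proof. by rewrite /adj map_mx1 trmx1. Qed.

Lemma adjD m n (A B : 'M[C]_(m, n)) : adj (A + B) = adj A + adj B.
Proof. by rewrite /adj map_mxD linearD. Qed.

Lemma adjZ m n a (A : 'M[C]_(m, n)) : adj (a *: A) = conjc a *: adj A.
Proof. by rewrite /adj map_mxZ linearZ. Qed.

Definition sqnorm d (v : 'cV[C]_d) : R := \sum_i abs2 (v i 0).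

Definition dot d (u v : 'cV[C]_d) : C := (adj u *m v) 0 0.

Lemma sqnorm_ge0 d (v : 'cV[C]_d) : 0 <= sqnorm v.
Proof. by apply: sumr_ge0 => i _; rewrite addr_ge0 ?sqr_ge0. Qed.

Lemma dot_self d (v : 'cV[C]_d) : dot v v = Complex (sqnorm v) 0.
Proof.
rewrite /dot mxE /sqnorm -[RHS]/(real_complex R _) rmorph_sum; apply: eq_bigr => i _.
rewrite !mxE; case: (v i 0) => a b; apply/eqP; rewrite eq_complex/= /abs2/=.
by apply/andP; split; apply/eqP; ring.
Qed.

Lemma dotC d (u v : 'cV[C]_d) : dot v u = conjc (dot u v).
Proof.
rewrite /dot !mxE rmorph_sum; apply: eq_bigr => i _.
by rewrite !mxE rmorphM/= conjcK mulrC.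
Qed.

Lemma dotDr d (u v w : 'cV[C]_d) : dot u (v + w) = dot u v + dot u w.
Proof. by rewrite /dot mulmxDr mxE. Qed.

Lemma dotZr d a (u v : 'cV[C]_d) : dot u (a *: v) = a * dot u v.
Proof. by rewrite /dot -scalemxAr mxE. Qed.

Lemma dotDl d (u v w : 'cV[C]_d) : dot (v + w) u = dot v u + dot w u.
Proof. by rewrite /dot adjD mulmxDl mxE. Qed.

Lemma dotZl d a (u v : 'cV[C]_d) : dot (a *: v) u = conjc a * dot v u.
Proof. by rewrite /dot adjZ -scalemxAl mxE. Qed.

Lemma dot_adj d (A : 'M[C]_d) u v : dot (A *m u) v = dot u (adj A *m v).
Proof. by rewrite /dot adjM mulmxA. Qed.

Lemma abs2M (z w : C) : abs2 (z * w) = abs2 z * abs2 w.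
Proof. by case: z w => a b [c d]; rewrite /abs2/=; ring. Qed.

(** Cauchy-Schwarz for a unit vector: the right-hand side minus the left is the squared norm of [v]
    after its projection onto [u] is removed. *)
Lemma abs2_le_sqnorm d (u v : 'cV[C]_d) : sqnorm u = 1 -> abs2 (dot u v) <= sqnorm v.
Proof.
move=> u1; have := sqnorm_ge0 (v + (- dot u v) *: u).
suff -> : sqnorm (v + (- dot u v) *: u) = sqnorm v - abs2 (dot u v) by rewrite subr_ge0.
have := dot_self (v + (- dot u v) *: u).
rewrite dotDl !dotDr !dotZl !dotZr (dotC u v) (dot_self u) (dot_self v) u1.
case: (dot u v) => a b /(congr1 (@complex.Re R))/= <-.
by rewrite /abs2/=; ring.
Qed.

Lemma unitary_mulmxr d (A : 'M[C]_d) : unitary A -> A *m adj A = 1%:M.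
Proof. exact: mulmx1C. Qed.

Lemma unitaryM d (A B : 'M[C]_d) : unitary A -> unitary B -> unitary (A *m B).
Proof.
by rewrite /unitary => uA uB; rewrite adjM mulmxA -(mulmxA (adj B)) uA mulmx1.
Qed.

Lemma unitary1 d : unitary (1%:M : 'M[C]_d).
Proof. by rewrite /unitary adj1 mulmx1. Qed.

Lemma unitary_adj d (A : 'M[C]_d) : unitary A -> unitary (adj A).
Proof. by rewrite /unitary adjK => /unitary_mulmxr. Qed.

Lemma unitary_dot d (A : 'M[C]_d) u v : unitary A -> dot (A *m u) (A *m v) = dot u v.
Proof. by move=> uA; rewrite dot_adj mulmxA uA mul1mx. Qed.

Lemma unitary_sqnorm d (A : 'M[C]_d) v : unitary A -> sqnorm (A *m v) = sqnorm v.
Proof. by move=> uA; have := unitary_dot v v uA; rewrite !dot_self => -[]. Qed.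

End ComplexLinearAlgebra.

(** * Exponentials of Hermitian matrices *)

Section MatrixExponential.
Variable R : realType.
Local Notation C := (complex R).
Local Open Scope classical_set_scope.

(** Real and imaginary parts are kept apart because [expmx] takes its entrywise limits in this
    form. *)
Definition cvgC (S : nat -> C) (z : C) :=
  (fun N => complex.Re (S N)) @ \oo --> complex.Re z /\
  (fun N => complex.Im (S N)) @ \oo --> complex.Im z.

Lemma cvgC_cstM a S z : cvgC S z -> cvgC (fun N => a * S N) (a * z).
Proof.
case: a z => a b [x y] [/= re im]; split=> /=.
  rewrite [X in X @ _ --> _](_ : _ =
    fun N => a * complex.Re (S N) - b * complex.Im (S N)); last first.
    by apply/funext => N; case: (S N).
  by apply: cvgB; apply: cvgM => //; exact: cvg_cst.
rewrite [X in X @ _ --> _](_ : _ =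
  fun N => a * complex.Im (S N) + b * complex.Re (S N)); last first.
  by apply/funext => N; case: (S N).
by apply: cvgD; apply: cvgM => //; exact: cvg_cst.
Qed.

Lemma cvgC_sum (I : Type) (s : seq I) (S : I -> nat -> C) (z : I -> C) :
  (forall i, cvgC (S i) (z i)) ->
  cvgC (fun N => \sum_(i <- s) S i N) (\sum_(i <- s) z i).
Proof.
move=> Sz; elim: s => [|i s [ihr ihi]].
  rewrite big_nil; have -> : (fun N => \sum_(i <- [::]) S i N) = (fun=> 0).
    by apply/funext => N; rewrite big_nil.
  by split; exact: cvg_cst.
rewrite big_cons; have -> : (fun N => \sum_(j <- i :: s) S j N) =
    (fun N => S i N + \sum_(j <- s) S j N).
  by apply/funext => N; rewrite big_cons.
have ReD (u v : C) : complex.Re (u + v) = complex.Re u + complex.Re v by case: u v => ? ? [].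
have ImD (u v : C) : complex.Im (u + v) = complex.Im u + complex.Im v by case: u v => ? ? [].
have [Sr Si] := Sz i; split.
  by rewrite ReD; under eq_fun do rewrite ReD; exact: cvgD.
by rewrite ImD; under eq_fun do rewrite ImD; exact: cvgD.
Qed.

Lemma expmx_cvg d (A B : 'M[C]_d) :
  (forall i j, cvgC (fun N => (\sum_(k < N) (k`!%:R)^-1 *: A ^+ k) i j) (B i j)) ->
  expmx A = B.
Proof.
move=> AB; apply/matrixP => i j; rewrite mxE.
have [re im] := AB i j; apply/eqP; rewrite eq_complex/=.
by rewrite (cvg_lim _ re)// (cvg_lim _ im)// !eqxx.
Qed.

Lemma imaginary_exp_coeff (x : R) k :
  (k`!%:R)^-1 * (- Complex 0 x) ^+ k = Complex (cos_coeff x k) (- sin_coeff x k).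
Proof.
(* The exponents [n./2] and [n.-1./2] are those of [cos_coeff] and [sin_coeff]. *)
have powE n : (- Complex 0 x) ^+ n =
   Complex ((~~ odd n)%:R * (-1) ^+ n./2 * x ^+ n)
           (- ((odd n)%:R * (-1) ^+ n.-1./2 * x ^+ n)).
  elim: n => [|n ih].
    by apply/eqP; rewrite eq_complex/=; apply/andP; split; apply/eqP; ring.
  rewrite exprSr ih; apply/eqP; rewrite eq_complex/= uphalf_half exprD exprSr.
  case: (boolP (odd n)) => [on|_] /=.
    have -> : n.-1./2 = n./2 by case: n on {ih} => //= n; rewrite uphalf_half => /negbTE ->.
    by apply/andP; split; apply/eqP; ring.
  by apply/andP; split; apply/eqP; ring.
have -> : (k`!%:R)^-1 = Complex (k`!%:R^-1) 0 :> C.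
  by rewrite -[RHS]/(real_complex R _) fmorphV rmorph_nat.
rewrite powE; apply/eqP; rewrite eq_complex/= cos_coeffE sin_coeffE/=.
by apply/andP; split; apply/eqP; ring.
Qed.

Lemma imaginary_exp_cvg (x : R) :
  cvgC (fun N => \sum_(k < N) (k`!%:R)^-1 * (- Complex 0 x) ^+ k)
       (Complex (cos x) (- sin x)).
Proof.
have sumE N : \sum_(k < N) (k`!%:R)^-1 * (- Complex 0 x) ^+ k =
    Complex (series (cos_coeff x) N) (- series (sin_coeff x) N).
  rewrite /series/= !big_mkord; elim: N => [|N ih].
    by rewrite !big_ord0 oppr0.
  rewrite !big_ord_recr/= ih imaginary_exp_coeff; apply/eqP; rewrite eq_complex/=.
  by rewrite opprD !eqxx.
split=> /=; under eq_fun do rewrite sumE/=.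
  by rewrite unlock; exact: is_cvg_series_cos_coeff.
by apply: cvgN; rewrite unlock; exact: is_cvg_series_sin_coeff.
Qed.

(** Powers of X D Y keep X and Y outside, so each entry of a partial sum is a fixed finite
    combination of scalar partial sums. Scalar convergence on the diagonal thus suffices. *)
Lemma expmx_diagonalizable d (X Y : 'M[C]_d) (D e : 'rV[C]_d) : Y *m X = 1%:M ->
  (forall l, cvgC (fun N => \sum_(k < N) (k`!%:R)^-1 * D 0 l ^+ k) (e 0 l)) ->
  expmx (X *m diag_mx D *m Y) = X *m diag_mx e *m Y.
Proof.
move=> YX De.
have XY : X *m Y = 1%:M by exact: mulmx1C.
have powE k : (X *m diag_mx D *m Y) ^+ k =
    X *m diag_mx (\row_l D 0 l ^+ k) *m Y.
  elim: k => [|k ih].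
    rewrite expr0 (_ : diag_mx _ = 1%:M) ?mulmx1//.
    by apply/matrixP => i j; rewrite !mxE.
  rewrite exprSr ih -[LHS]/(_ *m _) !mulmxA -(mulmxA _ Y X) YX mulmx1.
  rewrite -(mulmxA X) mulmx_diag; congr (_ *m diag_mx _ *m _).
  by apply/rowP => l; rewrite !mxE exprSr.
have entryE (f : 'rV[C]_d) i j :
    (X *m diag_mx f *m Y) i j = \sum_l X i l * Y l j * f 0 l.
  rewrite mul_mx_diag mxE; apply: eq_bigr => l _.
  by rewrite !mxE mulrAC.
apply: expmx_cvg => i j; rewrite entryE.
have -> : (fun N => (\sum_(k < N) (k`!%:R)^-1 *: (X *m diag_mx D *m Y) ^+ k) i j) =
   (fun N => \sum_l X i l * Y l j * \sum_(k < N) (k`!%:R)^-1 * D 0 l ^+ k).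
  apply/funext => N; rewrite summxE.
  under eq_bigr do rewrite mxE powE entryE mulr_sumr.
  rewrite exchange_big/=; apply: eq_bigr => l _; rewrite mulr_sumr.
  by apply: eq_bigr => k _; rewrite mxE mulrCA.
by apply: cvgC_sum => l; exact: cvgC_cstM.
Qed.

Lemma hermitian_spectral d (A : 'M[C]_d) : is_hermitian A ->
  exists (X : 'M[C]_d) (l : 'I_d -> R),
    unitary X /\ A = adj X *m diag_mx (\row_i Complex (l i) 0) *m X.
Proof.
move=> hA.
have adjE (B : 'M[C]_d) : map_mx Num.conj B^T = adj B.
  by apply/matrixP => i j; rewrite !mxE.
have hsA : A \is hermsymmx.
  by apply/is_hermitianmxP; rewrite expr0 scale1r adjE hA.
have /orthomx_spectralP AE := hermitian_normalmx hsA.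
have /mxOverP dreal := hermitian_spectral_diag_real hsA.
have Xu := spectral_unitarymx A.
exists (spectralmx A), (fun i => complex.Re (spectral_diag A 0 i)); split.
  rewrite /unitary; apply: mulmx1C.
  by have /unitarymxP := Xu; rewrite adjE.
have DE : \row_i Complex (complex.Re (spectral_diag A 0 i)) 0 = spectral_diag A.
  apply/rowP => i; rewrite mxE; have := dreal 0 i.
  by case: (spectral_diag A 0 i) => a b; rewrite complex_real => /eqP ->.
by rewrite DE -adjE -(invmx_unitary Xu).
Qed.

Lemma expmx_hermitian d (X : 'M[C]_d) (l : 'I_d -> R) (t : R) : unitary X ->
  expmx (- Complex 0 t *: (adj X *m diag_mx (\row_i Complex (l i) 0) *m X)) =
  adj X *m diag_mx (\row_i Complex (cos (t * l i)) (- sin (t * l i))) *m X.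
Proof.
move=> uX.
have -> : - Complex 0 t *: (adj X *m diag_mx (\row_i Complex (l i) 0) *m X) =
   adj X *m diag_mx (\row_i (- Complex 0 (t * l i))) *m X.
  rewrite scalemxAl scalemxAr; congr (_ *m _ *m _).
  apply/matrixP => i j; rewrite !mxE; case: eqP => _; rewrite ?mulr0// !mulr1n.
  by apply/eqP; rewrite eq_complex/=; apply/andP; split; apply/eqP; ring.
apply: expmx_diagonalizable => [|i]; first exact: unitary_mulmxr.
by rewrite !mxE; exact: imaginary_exp_cvg.
Qed.

End MatrixExponential.

(** * Pauli rotations and short-time evolution *)

Section Evolution.
Variable R : realType.
Local Notation C := (complex R).

Lemma diag_unitary_conj d (X : 'M[C]_d) (D : 'rV[C]_d) : unitary X ->
  adj X *m diag_mx D *m X = 1%:M -> forall i, D 0 i = 1.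
Proof.
move=> uX XD i.
have : diag_mx D = 1%:M.
  have uX' := unitary_mulmxr uX.
  rewrite -(mul1mx (diag_mx D)) -(mulmx1 (_ *m _)) -uX' !mulmxA.
  by rewrite -(mulmxA X (adj X)) -(mulmxA X) XD mulmx1.
by move=> /matrixP/(_ i i); rewrite !mxE eqxx !mulr1n.
Qed.

Lemma diag_mulmx_diag d (X : 'M[C]_d) (D e : 'rV[C]_d) : unitary X ->
  (adj X *m diag_mx D *m X) *m (adj X *m diag_mx e *m X) =
  adj X *m diag_mx (\row_i (D 0 i * e 0 i)) *m X.
Proof.
move=> uX; rewrite !mulmxA -(mulmxA _ X (adj X)) unitary_mulmxr// mulmx1.
by rewrite -(mulmxA (adj X)) mulmx_diag.
Qed.

(** Since s^2 = 1, every eigenvalue l is 1 or -1, and then cos(t l) - i sin(t l) = cos t - i l sin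
    t. Both sides are diagonal in the same eigenbasis. *)
Lemma rotE d (s : 'M[C]_d) t : is_hermitian s -> s *m s = 1%:M ->
  Defs.rot t s = Complex (cos t) 0 *: 1%:M + Complex 0 (- sin t) *: s.
Proof.
move=> hs s2; have [X [l [uX sE]]] := hermitian_spectral hs.
have l2 i : l i ^+ 2 = 1.
  have := s2; rewrite {1 2}sE diag_mulmx_diag// => /(diag_unitary_conj uX)/(_ i).
  by rewrite !mxE => /(congr1 (@complex.Re R))/=; rewrite mulr0 subr0.
rewrite /Defs.rot {1}sE expmx_hermitian//.
have -> : 1%:M = adj X *m diag_mx (const_mx 1) *m X.
  by rewrite diag_const_mx mulmx1.
have Z a D : a *: (adj X *m D *m X) = adj X *m (a *: D) *m X.
  by rewrite scalemxAl scalemxAr.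
rewrite sE !Z -mulmxDl -mulmxDr; congr (_ *m _ *m _).
apply/matrixP => i j; rewrite !mxE; case: eqP => _; last by rewrite !mulr0n !mulr0 addr0.
rewrite !mulr1n.
have /eqP := l2 i; rewrite sqrf_eq1 => /orP[] /eqP ->;
  apply/eqP; rewrite eq_complex/= ?mulr1 ?mulrN1 ?cosN ?sinN;
  by apply/andP; split; apply/eqP; ring.
Qed.

(** [Emax] is a supremum, so the set must also be shown bounded: a nonzero coordinate j of an
    eigenvector in the basis X identifies its eigenvalue as [l j], and the sum of all |l j| is an
    upper bound. Membership of |l i| is witnessed by row [i] of X, a left eigenvector. *)
Lemma spectral_le_Emax d (X : 'M[C]_d) (l : 'I_d -> R) i : unitary X ->
  `|l i| <= Emax (adj X *m diag_mx (\row_i Complex (l i) 0) *m X).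
Proof.
move=> uX; set D := diag_mx _; set A := _ *m X.
have uX' := unitary_mulmxr uX.
have XA : X *m A = D *m X by rewrite /A !mulmxA uX' mul1mx.
have normR (x : R) : `|Complex x 0| = Complex `|x| 0.
  by rewrite normc_def/= expr0n addr0 sqrtr_sqr.
apply: ub_le_sup.
  exists (\sum_j `|l j|) => x [z [/eigenvalueP[v vA v0] zx]].
  have : exists j, (v *m adj X) 0 j != 0.
    apply/existsP; apply: contraNT v0; rewrite negb_exists => /forallP vX0.
    have -> : v = v *m adj X *m X by rewrite -mulmxA uX mulmx1.
    rewrite (_ : v *m adj X = 0) ?mul0mx//.
    by apply/rowP => j; rewrite [RHS]mxE; apply/eqP; have := vX0 j; rewrite negbK.
  move=> [j wj].
  have : (v *m adj X) *m D = z *: (v *m adj X).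
    by rewrite scalemxAl -vA /A !mulmxA -(mulmxA _ X (adj X)) uX' mulmx1.
  move=> /rowP/(_ j); rewrite mul_mx_diag !mxE => wz.
  have {}wz : z = Complex (l j) 0.
    by move: wj wz; rewrite !mxE => wj; rewrite mulrC => /(mulIf wj).
  move: zx; rewrite wz normR => -[<-].
  by rewrite (bigD1 j)//= lerDl sumr_ge0.
exists (Complex (l i) 0); split; last exact: normR.
apply/eigenvalueP; exists (row i X).
  by rewrite -row_mul XA /D mul_diag_mx; apply/rowP => j; rewrite !mxE.
apply/eqP => /(congr1 (mulmx^~ (adj X))); rewrite -row_mul uX' mul0mx.
by move=> /rowP/(_ i); rewrite !mxE eqxx => /eqP; rewrite oner_eq0.
Qed.

Section HermitianEvolution.
Variables (d : nat) (H : 'M[C]_d) (dt : R).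
Hypothesis hermH : is_hermitian H.
Local Notation T := (expmx (- Complex 0 dt *: H)).

Lemma evolution_unitary : unitary T.
Proof.
have [X [l [uX ->]]] := hermitian_spectral hermH.
rewrite expmx_hermitian// /unitary.
rewrite !adjM adjK; set e := \row_i _.
have -> : adj (diag_mx e) = diag_mx (\row_i Complex (cos (dt * l i)) (sin (dt * l i))).
  apply/matrixP => i j; rewrite !mxE eq_sym; case: eqP => [->|_]; last first.
    by rewrite !mulr0n conjc0.
  by rewrite !mulr1n/= opprK.
rewrite (mulmxA (adj X)) diag_mulmx_diag//.
set D := (X in diag_mx X); have -> : D = const_mx 1.
  apply/rowP => i; rewrite /D !mxE; apply/eqP; rewrite eq_complex/=.
  apply/andP; split; apply/eqP; last by ring.
  by rewrite -(cos2Dsin2 (dt * l i)); ring.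
by rewrite diag_const_mx mulmx1.
Qed.

(** In the eigenbasis T - 1 multiplies coordinate i by exp(-i x) - 1 with x = dt l_i, of squared
    modulus 2 - 2 cos x <= x^2. *)
Lemma evolution_dist v : 0 <= dt ->
  sqnorm (T *m v - v) <= (Emax H * dt) ^+ 2 * sqnorm v.
Proof.
move=> dt0; have [X [l [uX HE]]] := hermitian_spectral hermH.
have lE i := spectral_le_Emax l i uX.
rewrite [in Emax _]HE [in T]HE expmx_hermitian//; move: lE; set Em := Emax _ => lE.
set e := \row_i _.
have -> : adj X *m diag_mx e *m X *m v - v =
    adj X *m (diag_mx (e - const_mx 1) *m (X *m v)).
  rewrite linearB/= diag_const_mx mulmxBl mul1mx mulmxBr !mulmxA.
  by rewrite uX mul1mx.
rewrite (unitary_sqnorm _ (unitary_adj uX)) -(unitary_sqnorm v uX).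
rewrite /sqnorm mulr_sumr; apply: ler_sum => i _.
rewrite mul_diag_mx !mxE abs2M ler_wpM2r//; first by rewrite addr_ge0 ?sqr_ge0.
rewrite /abs2/=.
have -> : (cos (dt * l i) - 1) ^+ 2 + (- sin (dt * l i) - 0) ^+ 2 =
    2 - 2 * cos (dt * l i).
  have -> : (cos (dt * l i) - 1) ^+ 2 + (- sin (dt * l i) - 0) ^+ 2 =
    cos (dt * l i) ^+ 2 + sin (dt * l i) ^+ 2 + 1 - 2 * cos (dt * l i) by ring.
  by rewrite cos2Dsin2; ring.
apply: (@le_trans _ _ ((dt * l i) ^+ 2)).
  by have := cos_ge_quadratic (dt * l i); lra.
rewrite -(real_normK (num_real (dt * l i))) normrM (ger0_norm dt0) mulrC.
by rewrite lerXn2r ?nnegrE ?mulr_ge0// ?(le_trans _ (lE i))// ler_wpM2r.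
Qed.

Hypothesis dt_ge0 : 0 <= dt.
Let eps := Emax H * dt.

(** With a = Re <v, T v>, the squared distance of T v from v is 2 - 2a, at most eps^2; hence a^2 >=
    2a - 1 >= 1 - eps^2. *)
Lemma survival_ge v : sqnorm v = 1 -> 1 - eps ^+ 2 <= abs2 (dot v (T *m v)).
Proof.
move=> v1; have := evolution_dist v dt_ge0; rewrite -/eps v1 mulr1.
set w := T *m v; have w1 : sqnorm w = 1 by rewrite unitary_sqnorm//; exact: evolution_unitary.
have := dot_self (w - v); rewrite -scaleN1r dotDl !dotDr !dotZl !dotZr.
rewrite (dotC v w) !dot_self w1 v1; case: (dot v w) => a b.
move=> /(congr1 (@complex.Re R))/= <-; rewrite /abs2/= => h.
have {}h : 2 - 2 * a <= eps ^+ 2 by lra.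
have [a0|a0] := leP 0 a; last first.
  by have := sqr_ge0 a; have := sqr_ge0 b; lra.
have := sqr_ge0 (a - 1); have := sqr_ge0 b.
rewrite (_ : (a - 1) ^+ 2 = a ^+ 2 - 2 * a + 1); last by ring.
by lra.
Qed.

(** Write T v = v + w with |w| <= eps. The three terms come from expanding |s + <u, w>|^2, using |s|
    <= 1 in the cross term. *)
Lemma transition_le u v (s : R) : sqnorm u = 1 -> sqnorm v = 1 -> 0 <= eps ->
  dot u v = Complex s 0 ->
  abs2 (dot u (T *m v)) <= s ^+ 2 + 2 * eps + eps ^+ 2.
Proof.
move=> u1 v1 e0 uv; have := evolution_dist v dt_ge0; rewrite -/eps v1 mulr1.
have s1 : s ^+ 2 <= 1.
  by have := abs2_le_sqnorm v u1; rewrite uv /abs2/= v1; lra.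
have -> : T *m v = v + (T *m v - v) by rewrite addrC subrK.
rewrite [X in sqnorm X]addrC addKr.
set w := T *m v - v => w_le; rewrite dotDr uv.
have := abs2_le_sqnorm w u1; case: (dot u w) => a b; rewrite /abs2/= => ab.
have ab_le : a ^+ 2 + b ^+ 2 <= eps ^+ 2 by exact: le_trans w_le.
have sa : s * a <= eps.
  apply: le_trans (ler_norm _) _; rewrite -(@ler_pXn2r _ 2) ?nnegrE//.
  rewrite real_normK ?num_real// exprMn; apply: le_trans (_ : 1 * a ^+ 2 <= _).
    by rewrite ler_wpM2r ?sqr_ge0.
  by have := sqr_ge0 b; lra.
have -> : (s + a) ^+ 2 + (0 + b) ^+ 2 = s ^+ 2 + 2 * (s * a) + (a ^+ 2 + b ^+ 2) by ring.
by lra.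
Qed.

End HermitianEvolution.
End Evolution.

(** * Parameterized circuits *)

Section ComplexSeparable.
Variables (R : realType) (N : nat).
Local Notation C := (complex R).
Implicit Types f g : (nat -> R) -> C.

Definition separableC f :=
  separable N (fun x => complex.Re (f x)) /\ separable N (fun x => complex.Im (f x)).

Lemma separableC_cst z : separableC (fun=> z).
Proof. by split; exact: separable_cst. Qed.

Lemma separableC_D f g : separableC f -> separableC g -> separableC (fun x => f x + g x).
Proof.
move=> [fr fi] [gr gi]; split.
  have -> : (fun x => complex.Re (f x + g x)) = (fun x => complex.Re (f x) + complex.Re (g x)).
    by apply/funext => x; case: (f x) (g x) => ? ? [].
  exact: separableD.
have -> : (fun x => complex.Im (f x + g x)) = (fun x => complex.Im (f x) + complex.Im (g x)).
  by apply/funext => x; case: (f x) (g x) => ? ? [].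
exact: separableD.
Qed.

Lemma separableC_M f g : separableC f -> separableC g -> separableC (fun x => f x * g x).
Proof.
move=> [fr fi] [gr gi]; split.
  have -> : (fun x => complex.Re (f x * g x)) =
      (fun x => complex.Re (f x) * complex.Re (g x) - complex.Im (f x) * complex.Im (g x)).
    by apply/funext => x; case: (f x) (g x) => ? ? [].
  by apply: separableB; exact: separableM.
have -> : (fun x => complex.Im (f x * g x)) =
    (fun x => complex.Re (f x) * complex.Im (g x) + complex.Im (f x) * complex.Re (g x)).
  by apply/funext => x; case: (f x) (g x) => ? ? [].
by apply: separableD; exact: separableM.
Qed.

Lemma separableC_conj f : separableC f -> separableC (fun x => conjc (f x)).
Proof.
move=> [fr fi]; split.
  have -> : (fun x => complex.Re (conjc (f x))) = (fun x => complex.Re (f x)) => //.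
  by apply/funext => x; case: (f x).
have -> : (fun x => complex.Im (conjc (f x))) = (fun x => -1 * complex.Im (f x)).
  by apply/funext => x; case: (f x) => a b /=; rewrite mulN1r.
exact: separableZ.
Qed.

Lemma separableC_sum (I : Type) (s : seq I) (f : I -> (nat -> R) -> C) :
  (forall i, separableC (f i)) -> separableC (fun x => \sum_(i <- s) f i x).
Proof.
move=> fs; elim: s => [|i s ih].
  have -> : (fun x => \sum_(i <- [::]) f i x) = (fun=> 0).
    by apply/funext => x; rewrite big_nil.
  exact: separableC_cst.
have -> : (fun x => \sum_(j <- i :: s) f j x) = (fun x => f i x + \sum_(j <- s) f j x).
  by apply/funext => x; rewrite big_cons.
exact: separableC_D.
Qed.

Lemma separable_abs2 f : separableC f -> separable N (fun x => abs2 (f x)).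
Proof. by move=> [fr fi]; apply: separableD; exact: separableM. Qed.

Lemma separableC_mulmx m n p (A : (nat -> R) -> 'M[C]_(m, n)) (B : (nat -> R) -> 'M[C]_(n, p)) :
  (forall i j, separableC (fun x => A x i j)) -> (forall i j, separableC (fun x => B x i j)) ->
  forall i j, separableC (fun x => (A x *m B x) i j).
Proof.
move=> As Bs i j.
have -> : (fun x => (A x *m B x) i j) = (fun x => \sum_k A x i k * B x k j).
  by apply/funext => x; rewrite mxE.
by apply: separableC_sum => k; exact: separableC_M.
Qed.

End ComplexSeparable.

Lemma hermitian_dot_real (R : realType) d (s : 'M[complex R]_d) v : is_hermitian s ->
  dot (s *m v) v = Complex (complex.Re (dot (s *m v) v)) 0.
Proof.
move=> hs; have : dot (s *m v) v = conjc (dot (s *m v) v).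
  by rewrite -dotC dot_adj hs.
case: (dot _ _) => a b [] /eqP; rewrite -addr_eq0 -mulr2n mulrn_eq0/= => /eqP ->.
by [].
Qed.

Section Circuit.
Variables (R : realType) (d M : nat).
Local Notation C := (complex R).
Variables sigma W : nat -> 'M[C]_d.
Hypothesis sigma_herm : forall k, (k < M)%N -> is_hermitian (sigma k).
Hypothesis sigma_sqr : forall k, (k < M)%N -> sigma k *m sigma k = 1%:M.
Hypothesis W_unitary : forall k, (k < M)%N -> unitary (W k).
Implicit Types (x : nat -> R) (k j : nat) (t a : R).
Local Notation U x k := (circuit sigma W x k).

Lemma circuit_unitary x k : (k <= M)%N -> unitary (U x k).
Proof.
elim: k => [|k ih] kM /=; first exact: unitary1.
apply: unitaryM; last exact/ih/ltnW.
by apply: unitaryM; [exact: W_unitary|apply: evolution_unitary; exact: sigma_herm].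
Qed.

Lemma circuit_upd_ge x k j t : (k <= j)%N -> U (upd x j t) k = U x k.
Proof.
elim: k => [//|k ih] kj /=; rewrite (ih (ltnW kj)).
by have -> : upd x j t k = x k by rewrite /upd (ltn_eqF kj).
Qed.

Lemma gateE k t : (k < M)%N -> Defs.rot t (sigma k) =
  Complex (cos t) 0 *: 1%:M + Complex 0 (- sin t) *: sigma k.
Proof. by move=> kM; apply: rotE; [exact: sigma_herm|exact: sigma_sqr]. Qed.

Lemma rot_split k t a : (k < M)%N -> Defs.rot t (sigma k) =
  Complex (cos (t - a)) 0 *: Defs.rot a (sigma k) +
  Complex (sin (t - a)) 0 *: Defs.rot (a + pi / 2) (sigma k).
Proof.
move=> kM; rewrite !gateE// cosDpihalf sinDpihalf.
rewrite -[in cos t](subrK a t) -[in sin t](subrK a t) (cosD (t - a)) (sinD (t - a)).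
apply/matrixP => i j; rewrite !mxE.
case: (sigma k i j) => p q; case: (i == j) => /=; rewrite ?mulr0n ?mulr1n;
  apply/eqP; rewrite eq_complex/=; apply/andP; split; apply/eqP; ring.
Qed.

Lemma mulmx_lincomb (A B1 B2 D : 'M[C]_d) z1 z2 :
  A *m (z1 *: B1 + z2 *: B2) *m D = z1 *: (A *m B1 *m D) + z2 *: (A *m B2 *m D).
Proof. by rewrite mulmxDr mulmxDl -2!scalemxAr -2!scalemxAl. Qed.

(** Angle [j] enters through a single gate, and a gate is determined by its values at [a] and
    [a + pi / 2]. *)
Lemma circuit_split x k j t a : (k <= M)%N -> (j < k)%N ->
  U (upd x j t) k = Complex (cos (t - a)) 0 *: U (upd x j a) k +
                    Complex (sin (t - a)) 0 *: U (upd x j (a + pi / 2)) k.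
Proof.
elim: k => [//|k ih] kM; rewrite ltnS leq_eqVlt => /orP[/eqP ->|jk] /=.
  have updE u : upd x k u k = u by rewrite /upd eqxx.
  rewrite !(circuit_upd_ge _ _ (leqnn k)) !updE (rot_split t a kM).
  by rewrite mulmx_lincomb.
have updE u : upd x j u k = x k by rewrite /upd (gtn_eqF jk).
rewrite (ih (ltnW kM) jk) !updE.
by rewrite mulmxDr -2!scalemxAr.
Qed.

Lemma gate_pihalf k a : (k < M)%N ->
  Defs.rot (a + pi / 2) (sigma k) = Defs.rot a (sigma k) *m (Complex 0 (-1) *: sigma k).
Proof.
move=> kM; rewrite !gateE// cosDpihalf sinDpihalf; have := sigma_sqr kM.
move: (sigma k) => S S2.
rewrite mulmxDl -2!scalemxAl mul1mx -scalemxAr S2 addrC 2!scalerA.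
by congr (_ *: _ + _ *: _); apply/eqP; rewrite eq_complex/=;
  apply/andP; split; apply/eqP; ring.
Qed.

(** Gate 0 is the rightmost factor and sigma commutes with its own rotation, so the extra factor
    ends up at the far right whatever the later gates are. *)
Lemma circuit_first_gate x k a : (k < M)%N ->
  U (upd x 0 (a + pi / 2)) k.+1 =
  U (upd x 0 a) k.+1 *m (Complex 0 (-1) *: sigma 0%N).
Proof.
elim: k => [|k ih] kM.
  have U1 y : U y 1 = W 0%N *m Defs.rot (y 0%N) (sigma 0%N) by exact: mulmx1.
  have updE u : upd x 0 u 0%N = u by [].
  by rewrite !U1 !updE (gate_pihalf _ kM) mulmxA.
have US y : U y k.+2 = W k.+1 *m Defs.rot (y k.+1) (sigma k.+1) *m U y k.+1 by [].
have updE u : upd x 0 u k.+1 = x k.+1 by [].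
by rewrite US ih ?(ltnW kM)// [in RHS]US !updE mulmxA.
Qed.

Lemma separableC_circuit k : (k <= M)%N ->
  forall i l, separableC M (fun x => U x k i l).
Proof.
elim: k => [|k ih] kM /=; first by move=> i j; exact: separableC_cst.
apply: separableC_mulmx; last exact/ih/ltnW.
apply: separableC_mulmx; first by move=> i j; exact: separableC_cst.
move=> i j.
have -> : (fun x => Defs.rot (x k) (sigma k) i j) =
   (fun x => Complex (cos (x k)) 0 * (1%:M : 'M[C]_d) i j +
             Complex 0 (-1 * sin (x k)) * sigma k i j).
  apply/funext => x; rewrite gateE//.
  by rewrite [LHS]mxE [X in X + _]mxE [X in _ + X]mxE mulN1r.
apply: separableC_D; apply: separableC_M; try exact: separableC_cst; split=> /=.
- by apply: separable_coord => //; exact: continuous_cos.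
- exact: separable_cst.
- exact: separable_cst.
- by apply: separableZ; apply: separable_coord => //; exact: continuous_sin.
Qed.

(** [w] stands for the evolved target state, which does not vary with [x]; only one circuit depends
    on the angles. *)
Definition fidelity (psi w : 'cV[C]_d) x : R := abs2 (dot (U x M *m psi) w).

Lemma separable_fidelity psi w : separable M (fidelity psi w).
Proof.
apply: separable_abs2; rewrite /dot /adj.
apply: separableC_mulmx => i j; last exact: separableC_cst.
have -> : (fun x => (map_mx (@conjc R) (U x M *m psi))^T i j) =
    (fun x => conjc ((U x M *m psi) j i)).
  by apply/funext => x; rewrite !mxE.
apply: separableC_conj; apply: separableC_mulmx => {i j}i j.
  exact: separableC_circuit.
exact: separableC_cst.
Qed.

Lemma quadratic_fidelity (c : nat -> R) k psi w : (k < M)%N ->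
  quadratic_in c k (fidelity psi w).
Proof.
move=> kM x.
set p := dot (U (upd x k (c k)) M *m psi) w.
set q := dot (U (upd x k (c k + pi / 2)) M *m psi) w.
(* The cross term 2 Re(p conj(q)) in the expansion of |p cos + q sin|^2. *)
exists (2 * (complex.Re p * complex.Re q + complex.Im p * complex.Im q)) => t.
rewrite /fidelity (circuit_split x t (c k) (leqnn M) kM).
rewrite mulmxDl -!scalemxAl dotDl !dotZl -/p -/q /abs2.
by case: p q => p1 p2 [q1 q2] /=; ring.
Qed.

Lemma fidelity01 psi w x : sqnorm psi = 1 -> sqnorm w = 1 -> 0 <= fidelity psi w x <= 1.
Proof.
move=> psi1 w1; rewrite /fidelity addr_ge0 ?sqr_ge0//= -[leRHS]w1.
by apply: abs2_le_sqnorm; rewrite unitary_sqnorm//; exact: circuit_unitary.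
Qed.

Section Contrast.
Variables (H : 'M[C]_d) (dt : R) (c : nat -> R) (psi : 'cV[C]_d).
Hypotheses (hermH : is_hermitian H) (dt_ge0 : 0 <= dt) (psi1 : sqnorm psi = 1).
Let T := expmx (- Complex 0 dt *: H).
Let w := T *m (U c M *m psi).

Lemma fidelity_center_ge : 1 - (Emax H * dt) ^+ 2 <= fidelity psi w c.
Proof.
apply: (survival_ge hermH dt_ge0).
by rewrite (unitary_sqnorm _ (circuit_unitary c (leqnn M))).
Qed.

(** The phase -i has modulus 1 and disappears. Unitarity of the circuit turns the overlap of the two
    states before evolution into <sigma psi, psi>, which is real because sigma is Hermitian, as
    [transition_le] requires. *)
Lemma fidelity_flip_le : (0 < M)%N -> 0 <= Emax H * dt ->
  fidelity psi w (upd c 0 (c 0%N + pi / 2)) <=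
  complex.Re (dot (sigma 0%N *m psi) psi) ^+ 2 + 2 * (Emax H * dt) + (Emax H * dt) ^+ 2.
Proof.
move=> M0 e0; have uU := circuit_unitary c (leqnn M).
have us : unitary (sigma 0%N) by rewrite /unitary (sigma_herm M0) (sigma_sqr M0).
have Uflip : U (upd c 0 (c 0%N + pi / 2)) M = U c M *m (Complex 0 (-1) *: sigma 0%N).
  rewrite -(prednK M0) circuit_first_gate ?upd_id//.
  by rewrite (prednK M0).
rewrite /fidelity Uflip -mulmxA -scalemxAl -scalemxAr dotZl abs2M.
have -> : abs2 (conjc (Complex 0 (-1))) = 1 :> R by rewrite /abs2/=; ring.
rewrite mul1r; apply: (transition_le hermH dt_ge0) => //.
- by rewrite (unitary_sqnorm _ uU) (unitary_sqnorm _ us).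
- by rewrite (unitary_sqnorm _ uU).
- by rewrite (unitary_dot _ _ uU); exact: hermitian_dot_real (sigma_herm M0).
Qed.

End Contrast.
End Circuit.

(** * From single fidelities to the averaged cost *)

Section QuadraticClosure.
Variables (R : realType) (c : nat -> R) (k : nat).
Implicit Types f g : (nat -> R) -> R.

Lemma quadratic_inD f g : quadratic_in c k f -> quadratic_in c k g ->
  quadratic_in c k (fun x => f x + g x).
Proof.
move=> fq gq x; have [u fE] := fq x; have [v gE] := gq x.
by exists (u + v) => t; rewrite fE gE; ring.
Qed.

Lemma quadratic_inZ a f : quadratic_in c k f -> quadratic_in c k (fun x => a * f x).
Proof.
by move=> fq x; have [u fE] := fq x; exists (a * u) => t; rewrite fE; ring.
Qed.

End QuadraticClosure.

Lemma unif_var_onem (R : realType) N r (c : nat -> R) f : 0 < r -> separable N f ->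
  unif_var N r c (fun x => 1 - f x) = unif_var N r c f.
Proof.
move=> r0 fs; rewrite /unif_var.
have s1 := @separable_cst R N 1.
have f2 : separable N (fun x => f x ^+ 2) by exact: separableM.
have -> : (fun x => (1 - f x) ^+ 2) = (fun x => (1 - 2 * f x) + f x ^+ 2).
  by apply/funext => x; ring.
have f3 := separableZ 2 fs.
rewrite (unif_expD c r0 c (leqnn N) (separableB s1 f3) f2).
rewrite (unif_expB c r0 c (leqnn N) s1 f3) (unif_expB c r0 c (leqnn N) s1 fs).
by rewrite (unif_expZ c r0 _ c (leqnn N) fs) unif_exp_cst//; ring.
Qed.

Lemma expval_dot (R : realType) d (psi : 'cV[complex R]_d) (V T U : 'M[complex R]_d) :
  expval psi (adj V *m T *m U) = dot (V *m psi) (T *m (U *m psi)).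
Proof. by rewrite /expval /dot adjM !mulmxA. Qed.

(** By cyclicity the trace is that of a product of two equal 1 x 1 matrices. This identifies the
    traces in [a] with squared expectation values of sigma. *)
Lemma tr_dens_conj (R : realType) d (s : 'M[complex R]_d) v : is_hermitian s ->
  \tr (s *m dens v *m s *m dens v) = dot (s *m v) v ^+ 2.
Proof.
move=> hs; rewrite /dens !mulmxA mxtrace_mulC !mulmxA.
have <- : adj (s *m v) *m v = adj v *m s *m v by rewrite adjM hs.
rewrite -(mulmxA _ s v) -(mulmxA _ (adj v)).
have -> : adj v *m (s *m v) = adj (s *m v) *m v by rewrite adjM hs mulmxA.
by rewrite [X in \tr X]mx11_scalar mxtrace_scalar mulr1n mxE big_ord1.
Qed.

Lemma sqnorm_unit (R : realType) d (v : 'cV[complex R]_d) :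
  adj v *m v = 1%:M -> sqnorm v = 1.
Proof. by move=> v1; have := dot_self v; rewrite /dot v1 mxE => -[]. Qed.

Lemma sqnorm_superposition (R : realType) d (u v : 'cV[complex R]_d) :
  sqnorm u = 1 -> sqnorm v = 1 -> dot u v = 0 ->
  sqnorm (Complex (Num.sqrt (2 : R))^-1 0 *: (u + v)) = 1.
Proof.
move=> u1 v1 uv; set z := Complex _ _.
have := dot_self (z *: (u + v)).
rewrite dotZl dotZr dotDl !dotDr (dotC u v) uv conjc0 !dot_self u1 v1.
move=> /(congr1 (@complex.Re R))/= <-.
have -> : forall w : R, w * (w * (1 + 0 + (0 + 1)) - 0 * (0 + 0 + (0 + 0))) -
   - 0 * (w * (0 + 0 + (0 + 0)) + 0 * (1 + 0 + (0 + 1))) = w ^+ 2 * 2.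
  by move=> w; ring.
by rewrite exprVn sqr_sqrtr// mulVf// pnatr_eq0.
Qed.

Lemma Emax_ge0 (R : realType) d (H : 'M[complex R]_d.+1) : is_hermitian H -> 0 <= Emax H.
Proof.
move=> hermH; have [X [l [uX ->]]] := hermitian_spectral hermH.
exact: le_trans (spectral_le_Emax l ord0 uX).
Qed.

Lemma big_seq3 (R : realType) (I : Type) (f : I -> R) i j k :
  \sum_(l <- [:: i; j; k]) f l = f i + f j + f k.
Proof. by rewrite !big_cons big_nil addr0 addrA. Qed.

(** Squaring gives 4e^2 + 4e + 1 < 3 - 2a, which is twice the claim; with e = Em dt this is the
    origin of the threshold on dt. *)
Lemma gap_gt0 (R : realType) (a e : R) : 0 <= e ->
  2 * e + 1 < Num.sqrt (3 - 2 * a) -> 0 < 1 - a - 2 * e - 2 * e ^+ 2.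
Proof.
move=> e0 sq.
have sq0 : 0 < Num.sqrt (3 - 2 * a) by apply: le_lt_trans sq; lra.
(* [Num.sqrt] vanishes on negative reals, so a positive root forces a positive radicand. *)
have a3 : 0 <= 3 - 2 * a by rewrite ltW// -sqrtr_gt0.
have : (2 * e + 1) ^+ 2 < 3 - 2 * a.
  by rewrite -(sqr_sqrtr a3) ltrXn2r// ?nnegrE ?sqrtr_ge0//; lra.
rewrite (_ : (2 * e + 1) ^+ 2 = 4 * e ^+ 2 + 4 * e + 1); last by ring.
by lra.
Qed.

Lemma radius_bound (R : realType) n (r r0 b : R) : (0 < n)%N -> 0 < b ->
  r ^+ 2 <= 3 * r0 ^+ 2 / n%:R * (b / (1 + b)) ->
  n%:R * (r ^+ 2 / 3) * (1 + b) <= r0 ^+ 2 * b.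
Proof.
move=> n_gt0 b0 r2_le.
have n0 : 0 < n%:R :> R by rewrite ltr0n.
have b1 : 0 < 1 + b by rewrite addr_gt0.
have := ler_wpM2l (_ : 0 <= n%:R / 3 * (1 + b)) r2_le.
have -> : n%:R / 3 * (1 + b) * (3 * r0 ^+ 2 / n%:R * (b / (1 + b))) = r0 ^+ 2 * b.
  by field; rewrite !lt0r_neq0.
have -> : n%:R / 3 * (1 + b) * r ^+ 2 = n%:R * (r ^+ 2 / 3) * (1 + b) by field.
by apply; rewrite mulr_ge0// ?divr_ge0// ltW.
Qed.

Lemma radius_sqr_le3 (R : realType) n (r r0 b : R) : (0 < n)%N -> 0 < b -> r0 ^+ 2 <= 1 ->
  n%:R * (r ^+ 2 / 3) * (1 + b) <= r0 ^+ 2 * b -> r ^+ 2 <= 3.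
Proof.
move=> n_gt0 b0 r0_le nb.
have n1 : 1 <= n%:R :> R by rewrite ler1n.
have b1 : 0 < 1 + b by rewrite addr_gt0.
have h1 : 1 * (r ^+ 2 / 3) * (1 + b) <= n%:R * (r ^+ 2 / 3) * (1 + b).
  by rewrite ler_pM2r// ler_wpM2r// divr_ge0// sqr_ge0.
have h2 : r0 ^+ 2 * b <= 1 * b by rewrite ler_pM2r.
have : r ^+ 2 / 3 * (1 + b) <= 1 * (1 + b) by lra.
by rewrite ler_pM2r//; lra.
Qed.

Lemma mean3_01 (R : realType) (x y z : R) : 0 <= x <= 1 -> 0 <= y <= 1 -> 0 <= z <= 1 ->
  0 <= 3^-1 * (x + y + z) <= 1.
Proof. by move=> /andP[? ?] /andP[? ?] /andP[? ?]; apply/andP; split; lra. Qed.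

Lemma contrast_arith (R : realType) (e q s0 s1 s2 x0 x1 x2 y0 y1 y2 : R) :
  1 - q <= x0 -> 1 - q <= x1 -> 1 - q <= x2 ->
  y0 <= s0 + 2 * e + q -> y1 <= s1 + 2 * e + q -> y2 <= s2 + 2 * e + q ->
  1 - 3^-1 * (s0 + s1 + s2) - 2 * e - 2 * q <=
  3^-1 * (x0 + x1 + x2) - 3^-1 * (y0 + y1 + y2).
Proof. by move=> *; lra. Qed.

Theorem theorem2 (R : realType) (n M : nat)
  (H : 'M[complex R]_(2 ^ n)) (dt : R)
  (psi0 psi1 : 'cV[complex R]_(2 ^ n))
  (sigma W : nat -> 'M[complex R]_(2 ^ n)) (phibar : nat -> R)
  (r0 r : R) :
  (2 <= M)%N ->
  is_hermitian H -> H != 0 ->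
  adj psi0 *m psi0 = 1%:M -> adj psi1 *m psi1 = 1%:M -> adj psi0 *m psi1 = 0 ->
  (forall i, (i < M)%N -> is_pauli_string (sigma i)) ->
  (forall i, (i < M)%N -> unitary (W i)) ->
  let psip := Complex (Num.sqrt (2 : R))^-1 0 *: (psi0 + psi1) in
  let rhos := [:: dens psi0; dens psi1; dens psip] in
  let a := 3^-1 * \sum_(rho <- rhos)
             complex.Re (\tr (sigma 0%N *m rho *m sigma 0%N *m rho)) in
  let Em := Emax H in
  let T := expmx ((- Complex 0 dt) *: H) in
  let Cost := fun phi : nat -> R =>
    1 - 3^-1 * \sum_(psi <- [:: psi0; psi1; psip])
       abs2 (expval psi (adj (circuit sigma W phi M) *m T *m circuit sigma W phibar M)) in
  0 < dt -> dt < (Num.sqrt (3 - 2 * a) - 1) / (2 * Em) ->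
  let b := 1 - a - 2 * Em * dt - 2 * Em ^+ 2 * dt ^+ 2 in
  0 < r0 -> r0 < 1 -> 0 < r ->
  r ^+ 2 <= 3 * r0 ^+ 2 / (M%:R - 1) * (b / (1 + b)) ->
  unif_var M r phibar Cost >=
    4 * r ^+ 4 / 45 * (1 - 4 * r ^+ 2 / 7) * (1 - r0 ^+ 2) ^+ 2 * b ^+ 2.
Proof.
move=> M2 hermH H0 psi0_1 psi1_1 psi01 sigmaP WU psip rhos a Em T Cost dt0 dt_lt b.
move=> r0_gt0 r0_lt1 r_gt0 r2_le.
case: M => [//|M'] in M2 sigmaP WU Cost r2_le *.
have sH k : (k < M'.+1)%N -> is_hermitian (sigma k).
  by move=> /sigmaP[p ->]; exact: pauli_string_adj.
have s2 k : (k < M'.+1)%N -> sigma k *m sigma k = 1%:M.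
  by move=> /sigmaP[p ->]; exact: pauli_string_sqr.
have n0 := sqnorm_unit psi0_1; have n1 := sqnorm_unit psi1_1.
have np : sqnorm psip = 1.
  by apply: sqnorm_superposition => //; rewrite /dot psi01 mxE.
have Em_ge0 : 0 <= Em.
  (* [Emax_ge0] asks for a nonzero dimension, so 2^n is rewritten as a successor. *)
  rewrite /Em; move: (H) hermH; rewrite -(prednK (expn_gt0 2 n : (0 < 2 ^ n)%N)).
  by move=> H'; exact: Emax_ge0.
have Em_gt0 : 0 < Em.
  (* If Em were 0, the upper bound on dt would be 0 by the convention that the inverse of 0 is 0,
     against dt > 0. *)
  rewrite lt_neqAle Em_ge0 andbT eq_sym; apply: contraTN dt_lt => /eqP ->.
  by rewrite mulr0 invr0 mulr0 -leNgt ltW.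
have e0 : 0 <= Em * dt by rewrite mulr_ge0// ltW.
pose w (psi : 'cV_(2 ^ n)) := T *m (circuit sigma W phibar M'.+1 *m psi).
pose f psi x := fidelity M'.+1 sigma W psi (w psi) x.
pose F x := 3^-1 * (f psi0 x + f psi1 x + f psip x).
have CostE : Cost = fun x => 1 - F x.
  apply/funext => x; rewrite /Cost big_seq3; congr (1 - _ * (_ + _ + _));
    by rewrite expval_dot.
have F_sep : separable M'.+1 F.
  apply: separableZ; apply: separableD; last exact: separable_fidelity.
  by apply: separableD; exact: separable_fidelity.
have F_quad k : (k < M'.+1)%N -> quadratic_in phibar k F.
  move=> kM; apply: quadratic_inZ; apply: quadratic_inD; last exact: quadratic_fidelity.
  by apply: quadratic_inD; exact: quadratic_fidelity.
have f01 psi x : sqnorm psi = 1 -> 0 <= f psi x <= 1.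
  move=> psi1'; apply: fidelity01 => //.
  rewrite /w (unitary_sqnorm _ (evolution_unitary dt hermH)).
  by rewrite (unitary_sqnorm _ (circuit_unitary sH WU phibar (leqnn _))).
have F01 x : 0 <= F x <= 1.
  move: (f01 _ x n0) (f01 _ x n1) (f01 _ x np); rewrite /F; exact: mean3_01.
pose s (psi : 'cV_(2 ^ n)) := complex.Re (dot (sigma 0%N *m psi) psi).
have aE : a = 3^-1 * (s psi0 ^+ 2 + s psi1 ^+ 2 + s psip ^+ 2).
  have trE psi : complex.Re (\tr (sigma 0%N *m dens psi *m sigma 0%N *m dens psi)) = s psi ^+ 2.
    rewrite (tr_dens_conj psi (sH 0%N isT)) (hermitian_dot_real psi (sH 0%N isT))/=.
    by rewrite mulr0 subr0.
  by rewrite /a big_seq3; congr (_ * (_ + _ + _)); exact: trE.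
have bE : b = 1 - a - 2 * (Em * dt) - 2 * (Em * dt) ^+ 2 by rewrite /b; ring.
have b_gt0 : 0 < b.
  rewrite bE; apply: gap_gt0 => //; move: dt_lt; rewrite ltr_pdivlMr ?mulr_gt0//.
  by rewrite ltrBrDr mulrCA [dt * _]mulrC.
have contrast : b <= F phibar - F (upd phibar 0 (phibar 0%N + pi / 2)).
  have lo psi : sqnorm psi = 1 -> _ := fidelity_center_ge sH WU phibar hermH (ltW dt0).
  have hi psi (p1 : sqnorm psi = 1) :=
    fidelity_flip_le sH s2 WU phibar hermH (ltW dt0) p1 (ltn0Sn M') e0.
  rewrite bE aE /F.
  exact: (contrast_arith (lo _ n0) (lo _ n1) (lo _ np) (hi _ n0) (hi _ n1) (hi _ np)).
have M'0 : (0 < M')%N by [].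
have r0_sqr : r0 ^+ 2 <= 1 by rewrite expr_le1// ltW.
have Mb : M'%:R * (r ^+ 2 / 3) * (1 + b) <= r0 ^+ 2 * b.
  have M1 : M'.+1%:R - 1 = M'%:R :> R by rewrite -natr1 addrK.
  by apply: radius_bound => //; rewrite -M1.
have r3 := radius_sqr_le3 M'0 b_gt0 r0_sqr Mb.
rewrite CostE unif_var_onem//.
by apply: (unif_var_ge_contrast r_gt0 F_sep F01 F_quad) => //; exact: ltW.
Qed.
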